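(* Let $R$ be a commutative Noetherian integral domain, let $G\in D^b(R\text{-mod})$ be an object and let $\{M_i\}_{i\in I}$ be a family of finitely generated $R$-modules such that, for some $n$, $M_i\in\langle G\rangle_n$ for every $i\in I$. Suppose there exist an integer $d\ge 1$ and a family of $R$-modules $\{N_i\}_{i\in I}$ such that $\bigcap_{i\in I}\operatorname{ann}\operatorname{Ext}^d_R(M_i,N_i)=0$. Then $n\ge d$.
   Context: $D^b(R\text{-mod})$ is the bounded derived category of finitely generated $R$-modules; a module is regarded as a complex concentrated in degree $0$. $\operatorname{ann}$ of an $R$-module is its annihilator ideal in $R$. In the triangulated category $\mathcal T=D^b(R\text{-mod})$: $[G]_0$ is the full subcategory of (objects isomorphic to) finite direct sums of shifts of $G$; for $k\ge 1$, $[G]_k$ is the full subcategory of objects $F$ for which there is a distinguished triangle $F_{k-1}\to F\to F_0\to F_{k-1}[1]$ with $F_0\in[G]_0$ and $F_{k-1}\in[G]_{k-1}$; and $\langle G\rangle_n$ ($n\ge 0$) is the full subcategory of direct summands in $\mathcal T$ of objects of $[G]_n$. *)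

(* Defs.v *)
From HB Require Import structures.
From mathcomp Require Import all_boot all_order all_algebra.
From mathcomp Require Import zify.
Set Implicit Arguments.
Unset Strict Implicit.
Unset Printing Implicit Defensive.
Import GRing.Theory.
Local Open Scope ring_scope.

Section FinitelyGenerated.
Variable R : comNzRingType.

Definition is_submodule (V : lmodType R) (S : V -> Prop) : Prop :=
  S 0 /\ forall (a : R) (u v : V), S u -> S v -> S (a *: u + v).

Definition fg_submodule (V : lmodType R) (S : V -> Prop) : Prop :=
  exists (m : nat) (g : 'I_m -> V),
    forall v, S v <-> exists c : 'I_m -> R, v = \sum_k c k *: g k.

Definition fin_gen (V : lmodType R) : Prop := fg_submodule (fun _ : V => True).

(* Ideals of R are the submodules of the regular module R^o. *)
Definition noetherian : Prop :=
  forall S : R^o -> Prop, is_submodule S -> fg_submodule S.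

Definition zero_module (V : lmodType R) : Prop := forall v : V, v = 0.

Definition mod0 : lmodType R := 'rV[R]_0.

Lemma zero_mod0 : zero_module mod0.
Proof. by move=> v; apply/rowP; case. Qed.

Lemma fin_gen_zero (V : lmodType R) : zero_module V -> fin_gen V.
Proof.
move=> V0; exists 0%N, (fun=> 0) => v; split=> // _.
by exists (fun=> 0); rewrite big_ord0.
Qed.

Lemma zero_prod (U V : lmodType R) :
  zero_module U -> zero_module V -> zero_module (U * V)%type.
Proof. by move=> U0 V0 [u v]; rewrite (U0 u) (V0 v). Qed.

Lemma fin_gen_prod (U V : lmodType R) :
  fin_gen U -> fin_gen V -> fin_gen (U * V)%type.
Proof.
case=> m [g gP] [k [h hP]].
pose w (t : 'I_(m + k)) : (U * V)%type :=
  match split t with inl a => (g a, 0) | inr b => (0, h b) end.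
have wl (a : 'I_m) : w (lshift k a) = (g a, 0).
  by rewrite /w (unsplitK (inl a : 'I_m + 'I_k)%type).
have wr (b : 'I_k) : w (rshift m b) = (0, h b).
  by rewrite /w (unsplitK (inr b : 'I_m + 'I_k)%type).
clearbody w.
exists (m + k)%N, w => -[u v]; split=> // _.
have [c ->] := (gP u).1 I; have [e ->] := (hP v).1 I.
exists (fun t => match split t with inl a => c a | inr b => e b end).
rewrite [RHS]surjective_pairing !raddf_sum /= !big_split_ord /=.
congr pair.
  rewrite [X in _ + X]big1 => [|b _]; last by rewrite wr scaler0.
  rewrite addr0; apply: eq_bigr => a _.
  by rewrite wl (unsplitK (inl a : 'I_m + 'I_k)%type).
rewrite [X in X + _]big1 => [|a _]; last by rewrite wl scaler0.
rewrite add0r; apply: eq_bigr => b _.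
by rewrite wr (unsplitK (inr b : 'I_m + 'I_k)%type).
Qed.

End FinitelyGenerated.

Section Complexes.
Variable R : comNzRingType.

(* Cohomological indexing by int. The differential X^i -> X^j takes a proof of
   i + 1 = j, so that X^(i+n+1) and X^(i+1+n) need not be convertible. *)
Record complex := Complex {
  obj :> int -> lmodType R;
  diff : forall i j : int, i + 1 = j -> {linear obj i -> obj j};
  diffK : forall (i j k : int) (e : i + 1 = j) (e' : j + 1 = k) (x : obj i),
    diff e' (diff e x) = 0 }.
Arguments diff X {i j} e : rename.

Record chmap (X Y : complex) := Chmap {
  cmap :> forall i : int, {linear X i -> Y i};
  cmapD : forall (i j : int) (e : i + 1 = j) (x : X i),
    cmap j (diff X e x) = diff Y e (cmap i x) }.

Definition chid (X : complex) : chmap X X :=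
  @Chmap X X (fun i => idfun) (fun _ _ _ _ => erefl).

Lemma chcompD (X Y Z : complex) (g : chmap Y Z) (f : chmap X Y)
    (i j : int) (e : i + 1 = j) (x : X i) :
  (g j \o f j) (diff X e x) = diff Z e ((g i \o f i) x).
Proof. by rewrite /= !cmapD. Qed.

Definition chcomp (X Y Z : complex) (g : chmap Y Z) (f : chmap X Y) :
  chmap X Z := @Chmap X Z (fun i => g i \o f i) (chcompD g f).

Definition cocycle (X : complex) (i : int) (x : X i) : Prop :=
  diff X (erefl (i + 1)) x = 0.

Definition coboundary (X : complex) (i : int) (x : X i) : Prop :=
  exists (j : int) (e : j + 1 = i) (w : X j), x = diff X e w.

(* The map induced on cocycles modulo coboundaries is injective and
   surjective in every degree. *)
Definition quasi_iso (X Y : complex) (f : chmap X Y) : Prop :=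
  forall i : int,
    (forall x : X i, cocycle x -> coboundary (f i x) -> coboundary x) /\
    (forall y : Y i, cocycle y ->
       exists2 x : X i, cocycle x & coboundary (f i x - y)).

Definition bounded (X : complex) : Prop :=
  exists a b : int, forall i : int, (i < a) || (b < i) -> zero_module (X i).

Definition bounded_fg (X : complex) : Prop :=
  bounded X /\ forall i : int, fin_gen (X i).

(* The shift X[n], with differential (-1)^n d. *)
Section Shift.
Variable n : int.

Lemma shift_eq (i j : int) : i + 1 = j -> i + n + 1 = j + n.
Proof. by move=> <-; rewrite addrAC. Qed.

Variable X : complex.

Definition shift_diff (i j : int) (e : i + 1 = j) (x : X (i + n)) : X (j + n) :=
  (-1) ^+ `|n|%N *: diff X (shift_eq e) x.

Lemma shift_diff_is_linear (i j : int) (e : i + 1 = j) : linear (shift_diff e).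
Proof.
by move=> a x y; rewrite /shift_diff linearP scalerDr !scalerA (mulrC a).
Qed.

HB.instance Definition _ (i j : int) (e : i + 1 = j) :=
  GRing.isLinear.Build R (X (i + n)) (X (j + n)) *:%R (shift_diff e)
    (shift_diff_is_linear e).

Lemma shift_diffK (i j k : int) (e : i + 1 = j) (e' : j + 1 = k)
    (x : X (i + n)) : shift_diff e' (shift_diff e x) = 0.
Proof. by rewrite /shift_diff linearZ /= diffK !scaler0. Qed.

Definition shift : complex :=
  @Complex (fun i => X (i + n)) (fun i j e => shift_diff e : {linear _ -> _})
    shift_diffK.

End Shift.

Lemma shift_cmapD (n : int) (X Y : complex) (f : chmap X Y)
    (i j : int) (e : i + 1 = j) (x : shift n X i) :
  f (j + n) (diff (shift n X) e x) = diff (shift n Y) e (f (i + n) x).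
Proof. by rewrite /= /shift_diff linearZ /= cmapD. Qed.

Definition shift_map (n : int) (X Y : complex) (f : chmap X Y) :
    chmap (shift n X) (shift n Y) :=
  @Chmap (shift n X) (shift n Y) (fun i => f (i + n)) (@shift_cmapD n X Y f).

Section DirectSum.
Variables X Y : complex.

Definition dsum_diff (i j : int) (e : i + 1 = j) (z : X i * Y i) : X j * Y j :=
  (diff X e z.1, diff Y e z.2).

Lemma dsum_diff_is_linear (i j : int) (e : i + 1 = j) : linear (dsum_diff e).
Proof. by move=> a x y; rewrite /dsum_diff !linearP. Qed.

HB.instance Definition _ (i j : int) (e : i + 1 = j) :=
  GRing.isLinear.Build R (X i * Y i)%type (X j * Y j)%type *:%R (dsum_diff e)
    (dsum_diff_is_linear e).

Lemma dsum_diffK (i j k : int) (e : i + 1 = j) (e' : j + 1 = k)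
    (x : X i * Y i) : dsum_diff e' (dsum_diff e x) = 0.
Proof. by rewrite /dsum_diff /= !diffK. Qed.

Definition dsum : complex :=
  @Complex (fun i => (X i * Y i)%type)
    (fun i j e => dsum_diff e : {linear _ -> _}) dsum_diffK.

End DirectSum.

(* The complex with M in degree 0 and zero in all other degrees. *)
Section Stalk.
Variable M : lmodType R.

Definition stalk_obj (i : int) : lmodType R := if i == 0 then M else mod0 R.

Definition stalk : complex :=
  @Complex stalk_obj (fun i j e => \0 : {linear stalk_obj i -> stalk_obj j})
    (fun _ _ _ _ _ _ => erefl).

End Stalk.

Definition transport (Y : complex) (i j : int) (e : i = j) (y : Y i) : Y j :=
  eq_rect i (fun k => Y k : Type) y j e.

(* The mapping cone of f : X -> Y: X^(i+1) (+) Y^i in degree i,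
   with differential (x, y) |-> (- d x, f x + d y). *)
Section Cone.
Variables (X Y : complex) (f : chmap X Y).

Definition cone_diff (i j : int) (e : i + 1 = j) (z : X (i + 1) * Y i) :
    X (j + 1) * Y j :=
  (diff (shift 1 X) e z.1, transport e (f (i + 1) z.1) + diff Y e z.2).

Lemma cone_diff_is_linear (i j : int) (e : i + 1 = j) : linear (cone_diff e).
Proof.
case: _ / e => a x y; rewrite /cone_diff /transport /= !linearP.
by congr pair; rewrite addrACA -scalerDr.
Qed.

HB.instance Definition _ (i j : int) (e : i + 1 = j) :=
  GRing.isLinear.Build R (X (i + 1)%R * Y i)%type (X (j + 1)%R * Y j)%type *:%R
    (cone_diff e) (cone_diff_is_linear e).

Lemma cone_diffK (i j k : int) (e : i + 1 = j) (e' : j + 1 = k)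
    (x : X (i + 1) * Y i) : cone_diff e' (cone_diff e x) = 0.
Proof.
case: _ / e'; case: _ / e; rewrite /cone_diff /= shift_diffK /transport /=.
congr pair; rewrite linearD diffK addr0 /shift_diff.
rewrite (eq_irrelevance (shift_eq _ _) (erefl (i + 1 + 1))).
by rewrite expr1 scaleN1r linearN /= cmapD addNr.
Qed.

Definition cone : complex :=
  @Complex (fun i => (X (i + 1)%R * Y i)%type)
    (fun i j e => cone_diff e : {linear _ -> _}) cone_diffK.

Definition cone_in_map (i : int) (y : Y i) : cone i := (0, y).

Lemma cone_in_is_linear (i : int) : linear (@cone_in_map i).
Proof.
move=> a x y; apply: (@eq_trans _ _ (a *: 0 + 0, a *: x + y)) => //.
by rewrite scaler0 addr0.
Qed.

HB.instance Definition _ (i : int) :=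
  GRing.isLinear.Build R (Y i) (cone i) *:%R (@cone_in_map i)
    (@cone_in_is_linear i).

Lemma cone_inD (i j : int) (e : i + 1 = j) (y : Y i) :
  cone_in_map (diff Y e y) = diff cone e (cone_in_map y).
Proof.
case: _ / e; rewrite /= /cone_diff /= /shift_diff /transport /= !linear0.
by rewrite add0r.
Qed.

Definition cone_in : chmap Y cone :=
  @Chmap Y cone (fun i => @cone_in_map i : {linear _ -> _}) cone_inD.

Definition cone_out : chmap cone (shift 1 X) :=
  @Chmap cone (shift 1 X)
    (fun i => (fst : X (i + 1) * Y i -> X (i + 1)) : {linear _ -> _})
    (fun _ _ _ _ => erefl).

End Cone.

Lemma shift_bounded_fg (n : int) (X : complex) :
  bounded_fg X -> bounded_fg (shift n X).
Proof.
case=> -[a [b X0]] Xfg; split=> [|i]; last exact: Xfg.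
by exists (a - n), (b - n) => i /= hi; apply: X0; lia.
Qed.

Lemma dsum_bounded_fg (X Y : complex) :
  bounded_fg X -> bounded_fg Y -> bounded_fg (dsum X Y).
Proof.
case=> -[a [b X0]] Xfg [[a' [b' Y0]] Yfg]; split=> [|i]; last first.
  exact: fin_gen_prod.
exists (Order.min a a'), (Order.max b b') => i hi.
by apply: zero_prod; [apply: X0 | apply: Y0]; lia.
Qed.

Lemma cone_bounded_fg (X Y : complex) (f : chmap X Y) :
  bounded_fg X -> bounded_fg Y -> bounded_fg (cone f).
Proof.
move=> /(shift_bounded_fg 1) hX hY.
exact: (dsum_bounded_fg hX hY).
Qed.

Lemma stalk_bounded_fg (M : lmodType R) : fin_gen M -> bounded_fg (stalk M).
Proof.
move=> Mfg; split=> [|i].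
  exists 0, 0 => i /=; rewrite /stalk_obj; case: eqP => [->|_ _] //.
  exact: zero_mod0.
rewrite /= /stalk_obj; case: eqP => // _; exact/fin_gen_zero/zero_mod0.
Qed.

Lemma shift_quasi_iso (n : int) (X Y : complex) (f : chmap X Y) :
  quasi_iso f -> quasi_iso (shift_map n f).
Proof.
have sK (V : lmodType R) (v : V) :
    (-1) ^+ `|n|%N *: ((-1) ^+ `|n|%N *: v) = v.
  by rewrite scalerA -exprMn mulrNN mulr1 expr1n scale1r.
have cocE Z i (z : shift n Z i) : cocycle z <-> @cocycle Z (i + n) z.
  rewrite /cocycle /= /shift_diff; move: (shift_eq _ _) => e.
  have dE (j : int) (e' : i + n + 1 = j) :
      diff Z e' z = 0 <-> diff Z (erefl (i + n + 1)) z = 0 by case: _ / e'.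
  split=> [h|h]; last by rewrite ((dE _ e).2 h) scaler0.
  by apply/(dE _ e); rewrite -[LHS]sK [X in _ *: X]h scaler0.
have cobE Z i (z : shift n Z i) : coboundary z <-> @coboundary Z (i + n) z.
  split=> [[j [e [w ->]]]|[j [e [w ->]]]].
    by exists (j + n), (shift_eq n e), ((-1) ^+ `|n|%N *: w); rewrite linearZ.
  have [j' jE] : exists j', j = j' + n by exists (j - n); rewrite subrK.
  subst j; have e' : j' + 1 = i by apply: (addIr n); rewrite addrAC.
  exists j', e', ((-1) ^+ `|n|%N *: w).
  by rewrite /= /shift_diff (eq_irrelevance (shift_eq n e') e) linearZ /= sK.
move=> hf i; have [inj surj] := hf (i + n); split=> [x /cocE hx /cobE hfx|].
  by apply/cobE; apply: inj.
move=> y /cocE /surj[x hx hxy].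
by exists x; [apply/cocE | apply/cobE].
Qed.

End Complexes.

Section DerivedCategory.
Variable R : comNzRingType.

Record dbcomplex := DbComplex {
  dbc :> complex R;
  dbcP : bounded_fg dbc }.

Definition db_shift (n : int) (X : dbcomplex) : dbcomplex :=
  DbComplex (shift_bounded_fg n (dbcP X)).

Definition db_dsum (X Y : dbcomplex) : dbcomplex :=
  DbComplex (dsum_bounded_fg (dbcP X) (dbcP Y)).

Definition db_cone (X Y : dbcomplex) (f : chmap X Y) : dbcomplex :=
  DbComplex (cone_bounded_fg f (dbcP X) (dbcP Y)).

Definition db_stalk (M : lmodType R) (Mfg : fin_gen M) : dbcomplex :=
  DbComplex (stalk_bounded_fg Mfg).

Definition db_zero : dbcomplex :=
  db_stalk (fin_gen_zero (@zero_mod0 R)).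

(* D^b(R-mod) is the localization of the category of bounded complexes of
   finitely generated modules at the quasi-isomorphisms. Its morphisms are the
   formal composites of chain maps and of formal inverses of
   quasi-isomorphisms, taken modulo the relation deq below, the smallest
   congruence that makes dmap a functor and dinv s an inverse of dmap s. *)
Inductive dmor : dbcomplex -> dbcomplex -> Type :=
| dmap (X Y : dbcomplex) (f : chmap X Y) : dmor X Y
| dinv (X Y : dbcomplex) (s : chmap X Y) (sP : quasi_iso s) : dmor Y X
| dcomp (X Y Z : dbcomplex) (v : dmor Y Z) (u : dmor X Y) : dmor X Z.

Definition did (X : dbcomplex) : dmor X X := dmap (chid X).

Inductive deq : forall X Y : dbcomplex, dmor X Y -> dmor X Y -> Prop :=
| deq_refl X Y (u : dmor X Y) : deq u u
| deq_sym X Y (u v : dmor X Y) : deq u v -> deq v u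
| deq_trans X Y (u v w : dmor X Y) : deq u v -> deq v w -> deq u w
| deq_comp X Y Z (v v' : dmor Y Z) (u u' : dmor X Y) :
    deq v v' -> deq u u' -> deq (dcomp v u) (dcomp v' u')
| deq_assoc X Y Z T (w : dmor Z T) (v : dmor Y Z) (u : dmor X Y) :
    deq (dcomp w (dcomp v u)) (dcomp (dcomp w v) u)
| deq_idl X Y (u : dmor X Y) : deq (dcomp (did Y) u) u
| deq_idr X Y (u : dmor X Y) : deq (dcomp u (did X)) u
| deq_map (X Y : dbcomplex) (f g : chmap X Y) :
    (forall i x, f i x = g i x) -> deq (dmap f) (dmap g)
| deq_map_comp (X Y Z : dbcomplex) (g : chmap Y Z) (f : chmap X Y) :
    deq (dmap (chcomp g f)) (dcomp (dmap g) (dmap f))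
| deq_invl (X Y : dbcomplex) (s : chmap X Y) (sP : quasi_iso s) :
    deq (dcomp (dinv sP) (dmap s)) (did X)
| deq_invr (X Y : dbcomplex) (s : chmap X Y) (sP : quasi_iso s) :
    deq (dcomp (dmap s) (dinv sP)) (did Y).

Definition is_iso (X Y : dbcomplex) (u : dmor X Y) : Prop :=
  exists v : dmor Y X, deq (dcomp v u) (did X) /\ deq (dcomp u v) (did Y).

Definition isomorphic (X Y : dbcomplex) : Prop :=
  exists u : dmor X Y, is_iso u.

Fixpoint dshift (n : int) (X Y : dbcomplex) (u : dmor X Y) :
    dmor (db_shift n X) (db_shift n Y) :=
  match u in dmor A B return dmor (db_shift n A) (db_shift n B) with
  | dmap A B f => @dmap (db_shift n A) (db_shift n B) (shift_map n f)
  | dinv A B s sP =>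
      @dinv (db_shift n A) (db_shift n B) (shift_map n s)
        (shift_quasi_iso n sP)
  | dcomp A B C v u' => dcomp (dshift n v) (dshift n u')
  end.

Definition dcone_in (X Y : dbcomplex) (f : chmap X Y) : dmor Y (db_cone f) :=
  @dmap Y (db_cone f) (cone_in f).

Definition dcone_out (X Y : dbcomplex) (f : chmap X Y) :
    dmor (db_cone f) (db_shift 1 X) :=
  @dmap (db_cone f) (db_shift 1 X) (cone_out f).

(* A -u-> B -v-> C -w-> A[1] is isomorphic, in the derived category, to the
   triangle X -f-> Y -> cone f -> X[1] of a chain map f. *)
Definition distinguished (A B C : dbcomplex)
    (u : dmor A B) (v : dmor B C) (w : dmor C (db_shift 1 A)) : Prop :=
  exists (X Y : dbcomplex) (f : chmap X Y)
         (a : dmor A X) (b : dmor B Y) (c : dmor C (db_cone f)),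
    [/\ is_iso a, is_iso b & is_iso c] /\
    [/\ deq (dcomp b u) (dcomp (dmap f) a),
        deq (dcomp c v) (dcomp (dcone_in f) b) &
        deq (dcomp (dshift 1 a) w) (dcomp (dcone_out f) c)].

(* build G k F: F lies in [G]_k. *)
Definition build0 (G F : dbcomplex) : Prop :=
  exists ns : seq int,
    isomorphic F (foldr db_dsum db_zero [seq db_shift n G | n <- ns]).

Fixpoint build (G : dbcomplex) (k : nat) (F : dbcomplex) : Prop :=
  match k with
  | 0 => build0 G F
  | k'.+1 =>
      exists (F1 F0 : dbcomplex)
             (u : dmor F1 F) (v : dmor F F0) (w : dmor F0 (db_shift 1 F1)),
        [/\ distinguished u v w, build0 G F0 & build G k' F1]
  end.

(* thick G n F: F lies in <G>_n, that is, F (+) F' is isomorphic to some E in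
   [G]_n. *)
Definition thick (G : dbcomplex) (n : nat) (F : dbcomplex) : Prop :=
  exists F' E : dbcomplex, build G n E /\ isomorphic (db_dsum F F') E.

End DerivedCategory.

Section Ext.
Variable R : comNzRingType.

Definition projective (P : lmodType R) : Prop :=
  forall (U V : lmodType R) (p : {linear U -> V}) (g : {linear P -> V}),
    (forall v, exists u, p u = v) ->
    exists h : {linear P -> U}, forall x, p (h x) = g x.

Record proj_resolution (M : lmodType R) := ProjResolution {
  res :> nat -> lmodType R;
  res_projective : forall k, projective (res k);
  res_diff : forall k, {linear res k.+1 -> res k};
  res_aug : {linear res 0%N -> M};
  res_aug_surj : forall m : M, exists x, res_aug x = m;
  res_exact0 : forall x : res 0%N,
    res_aug x = 0 <-> exists y, x = res_diff 0 y;
  res_exact : forall k (x : res k.+1),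
    res_diff k x = 0 <-> exists y, x = res_diff k.+1 y }.

Variables (M : lmodType R) (P : proj_resolution M) (N : lmodType R).

Definition ext_cocycle (d : nat) (c : {linear P d -> N}) : Prop :=
  forall x : P d.+1, c (res_diff P d x) = 0.

Definition ext_coboundary (d : nat) : {linear P d -> N} -> Prop :=
  match d with
  | 0 => fun c => forall x, c x = 0
  | d'.+1 => fun c =>
      exists b : {linear P d' -> N}, forall x, c x = b (res_diff P d' x)
  end.

(* r annihilates Ext^d(M, N) = H^d(Hom(P, N)), that is, r times every cocycle
   is a coboundary. *)
Definition ann_ext (d : nat) (r : R) : Prop :=
  forall c : {linear P d -> N}, ext_cocycle c ->
    ext_coboundary (r \*: c : {linear P d -> N}).

End Ext.

(* Main.v *)
Require Import Defs.
From HB Require Import structures.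
From mathcomp Require Import all_boot all_order all_algebra.
From mathcomp Require Import zify boolp.
Set Implicit Arguments.
Unset Strict Implicit.
Unset Printing Implicit Defensive.
Import GRing.Theory.
Local Open Scope ring_scope.

(** Suppose n < d. A nonzero r depending only on R and G is produced such that
    r ^+ n.+1 annihilates Ext^d(M_i, N) for every i and every N, contrary to
    the hypothesis.

    The test objects are cochain complexes P = (P^0 -> P^1 -> ...) of finite
    free modules whose R-dual is exact except at the dual of P^0. Let P^{>=k}
    be the subcomplex of the terms of index at least k, and [P^{>=k}, X] the
    homotopy classes of chain maps of all degrees. A chain map from P^{>=k} to
    a shift of R becomes null-homotopic on P^{>=k+1}: it is a functional on
    one P^j, which restricts to zero when j = k, and which for j > k vanishes
    on the image of P^(j-1), hence factors through P^(j+1) by exactness of the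
    dual. Over the fraction field, G is a sum of shifts of the field; clearing
    denominators, some r != 0 makes r times the restriction
    [P^{>=k}, G] -> [P^{>=k+1}, G] zero for all P and k (kills_generator). This
    property passes to shifts, direct sums, summands and isomorphic objects,
    and along a triangle the multipliers are multiplied and the truncation
    steps added (kills_triangle). So on <G>_n the multiplier r ^+ n.+1
    annihilates every n.+1-step restriction (kills_thick).

    To reach Ext^d(M, N), take a resolution L of M by finite free modules and
    let P begin with the differential L_d -> L_(d-1), continued by resolving
    its transpose. The identity of these two terms extends to a chain map from
    P to L, and so to M, and its restriction to P^{>=d} is annihilated by
    c = r ^+ n.+1. Lifting the null-homotopy back along L
    (stalk_contraction) writes c times the identity of L_d as a sum of a map
    factoring through L_d -> L_(d-1) and a map into the image of
    L_(d+1) -> L_d, so c annihilates Ext^d(M, -) (kills_ann_ext). In other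
    words, c annihilates the class in Tor_d(M, C) of the identity of L_d,
    where C is the cokernel of the transposed differential.

    Morphisms of the derived category are words in chain maps and formal
    inverses. They act on the classes [P^{>=k}, -] because a quasi-isomorphism
    of bounded complexes induces a bijection on them (quasi_iso_lift,
    quasi_iso_reflect); the action is written as a relation, compatible with
    the equality of words (dact_deq). *)

(** * Tuples of vectors under matrices *)

Section MatrixAction.
Variables (R : comNzRingType) (V : lmodType R).

(** A tuple y of n vectors is a linear map R^n -> V; this is its composite with
    the map R^m -> R^n given by A acting on row vectors. *)
Definition mxact m n (A : 'M[R]_(m, n)) (y : 'I_n -> V) (a : 'I_m) : V :=
  \sum_b A a b *: y b.

Lemma eq_mxact m n (A : 'M[R]_(m, n)) (y z : 'I_n -> V) a :
  y =1 z -> mxact A y a = mxact A z a.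
Proof. by move=> yz; apply: eq_bigr => b _; rewrite yz. Qed.

Lemma mxact_mul m n l (A : 'M[R]_(m, n)) (B : 'M_(n, l)) (y : 'I_l -> V) a :
  mxact A (mxact B y) a = mxact (A *m B) y a.
Proof.
rewrite /mxact; under eq_bigr do rewrite scaler_sumr.
rewrite exchange_big; apply: eq_bigr => c _.
rewrite mxE scaler_suml; apply: eq_bigr => b _; by rewrite scalerA.
Qed.

Lemma mxact0l m n (y : 'I_n -> V) (a : 'I_m) : mxact 0 y a = 0.
Proof. by apply: big1 => b _; rewrite mxE scale0r. Qed.

Lemma mxactDl m n (A B : 'M[R]_(m, n)) (y : 'I_n -> V) a :
  mxact (A + B) y a = mxact A y a + mxact B y a.
Proof. by rewrite -big_split; apply: eq_bigr => b _; rewrite mxE scalerDl. Qed.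

Lemma mxactZl m n c (A : 'M[R]_(m, n)) (y : 'I_n -> V) a :
  mxact (c *: A) y a = c *: mxact A y a.
Proof. by rewrite scaler_sumr; apply: eq_bigr => b _; rewrite mxE scalerA. Qed.

Lemma mxact0 m n (A : 'M[R]_(m, n)) (a : 'I_m) : mxact A (fun=> 0) a = 0.
Proof. by apply: big1 => b _; rewrite scaler0. Qed.

Lemma mxactD m n (A : 'M[R]_(m, n)) (y z : 'I_n -> V) (a : 'I_m) :
  mxact A (fun b => y b + z b) a = mxact A y a + mxact A z a.
Proof. by rewrite -big_split; apply: eq_bigr => b _; rewrite scalerDr. Qed.

Lemma mxactZ m n (A : 'M[R]_(m, n)) c (y : 'I_n -> V) (a : 'I_m) :
  mxact A (fun b => c *: y b) a = c *: mxact A y a.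
Proof.
by rewrite scaler_sumr; apply: eq_bigr => b _; rewrite !scalerA mulrC.
Qed.

Lemma mxactN m n (A : 'M[R]_(m, n)) (y : 'I_n -> V) (a : 'I_m) :
  mxact A (fun b => - y b) a = - mxact A y a.
Proof.
by rewrite -scaleN1r -mxactZ; apply: eq_mxact => b; rewrite scaleN1r.
Qed.

Lemma mxactB m n (A : 'M[R]_(m, n)) (y z : 'I_n -> V) (a : 'I_m) :
  mxact A (fun b => y b - z b) a = mxact A y a - mxact A z a.
Proof. by rewrite mxactD mxactN. Qed.

End MatrixAction.

Lemma linear_mxact (R : comNzRingType) (U V : lmodType R) (h : {linear U -> V})
    m n (A : 'M[R]_(m, n)) (y : 'I_n -> U) a :
  h (mxact A y a) = mxact A (fun b => h (y b)) a.
Proof. by rewrite linear_sum; apply: eq_bigr => b _; rewrite linearZ. Qed.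

Lemma mxact_row (R : comNzRingType) k m n (X : 'M[R]_(k, m)) (B : 'M[R]_(m, n))
    (a : 'I_k) : mxact X (fun b => row b B) a = row a (X *m B).
Proof.
by rewrite /mxact row_mul mulmx_sum_row; apply: eq_bigr => b _; rewrite mxE.
Qed.

(** * Submodules and Noetherian rings *)

Section Submodules.
Variables (R : comNzRingType) (V : lmodType R) (S : V -> Prop).
Hypothesis subS : is_submodule S.

Lemma submod0 : S 0. Proof. by case: subS. Qed.

Lemma submodD u v : S u -> S v -> S (u + v).
Proof. by case: subS => _ h Su Sv; rewrite -[u]scale1r; apply: h. Qed.

Lemma submodZ a u : S u -> S (a *: u).
Proof. by case: subS => S0 h Su; rewrite -[_ *: _]addr0; apply: h. Qed.

Lemma submodN u : S u -> S (- u).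
Proof. by rewrite -scaleN1r; apply: submodZ. Qed.

Lemma submodB u v : S u -> S v -> S (u - v).
Proof. by move=> Su Sv; apply/submodD/submodN. Qed.

Lemma submod_sum (I : finType) (F : I -> V) :
  (forall i, S (F i)) -> S (\sum_i F i).
Proof.
by move=> SF; apply: big_ind => //; [apply: submod0 | apply: submodD].
Qed.

Lemma submod_mxact m n (A : 'M[R]_(m, n)) y a :
  (forall b, S (y b)) -> S (mxact A y a).
Proof. by move=> Sy; apply: submod_sum => b; apply: submodZ. Qed.

End Submodules.

Section Noetherian.
Variables (R : comNzRingType).

Lemma fg_submodule_add (V : lmodType R) (S S1 S2 : V -> Prop) :
  (forall v, S v <-> exists v1 v2, [/\ v = v1 + v2, S1 v1 & S2 v2]) ->
  fg_submodule S1 -> fg_submodule S2 -> fg_submodule S.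
Proof.
move=> SE [m [g gP]] [k [h hP]].
pose w (t : 'I_(m + k)) := match split t with inl a => g a | inr b => h b end.
have wl (a : 'I_m) : w (lshift k a) = g a.
  by rewrite /w (unsplitK (inl a : 'I_m + 'I_k)%type).
have wr (b : 'I_k) : w (rshift m b) = h b.
  by rewrite /w (unsplitK (inr b : 'I_m + 'I_k)%type).
clearbody w.
exists (m + k)%N, w => v; rewrite SE; split; last first.
  case=> c ->; rewrite big_split_ord /=.
  exists (\sum_a c (lshift k a) *: g a), (\sum_b c (rshift m b) *: h b).
  split; last 2 first; first by apply/gP; exists (c \o lshift k).
    by apply/hP; exists (c \o @rshift m k).
  by congr (_ + _); apply: eq_bigr => i _; rewrite ?wl ?wr.
case=> v1 [v2 [-> /gP[c ->] /hP[e ->]]].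
exists (fun t => match split t with inl a => c a | inr b => e b end).
rewrite big_split_ord /=; congr (_ + _); apply: eq_bigr => i _.
  by rewrite wl (unsplitK (inl i : 'I_m + 'I_k)%type).
by rewrite wr (unsplitK (inr i : 'I_m + 'I_k)%type).
Qed.

Hypothesis noethR : noetherian R.

(** Induction on the number of generators of the ambient module: the
    coefficients of the first generator form an ideal. *)
Lemma noetherian_submodule (V : lmodType R) m (g : 'I_m -> V) (S : V -> Prop) :
  is_submodule S ->
  (forall v, S v -> exists c : 'I_m -> R, v = \sum_k c k *: g k) ->
  fg_submodule S.
Proof.
elim: m g S => [|m IHm] g S subS Sg.
  exists 0%N, (fun=> 0) => v; split=> [/Sg[c ->]|[c ->]].
    by exists (fun=> 0); rewrite !big_ord0.
  by rewrite big_ord0; apply: submod0.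
(* The vectors v of S whose coefficient on the first generator can be chosen
   to be c, for the various c, give the ideal J. *)
pose tail v := exists c : 'I_m -> R, v = \sum_k c k *: g (lift ord0 k).
have subT : is_submodule tail.
  split; first by exists (fun=> 0); rewrite big1 // => k _; rewrite scale0r.
  move=> a _ _ [c ->] [e ->]; exists (fun k => a * c k + e k).
  rewrite scaler_sumr -big_split; apply: eq_bigr => k _.
  by rewrite scalerDl scalerA.
pose J (c : R^o) := exists2 v, S v & tail (v - c *: g ord0).
have subJ : is_submodule J.
  split; first by exists 0; rewrite ?scale0r ?subr0; apply: submod0.
  move=> a c e [u Su Tu] [v Sv Tv]; exists (a *: u + v).
    by apply: submodD => //; apply: submodZ.
  have -> : a *: u + v - (a *: c + e) *: g ord0
          = a *: (u - c *: g ord0) + (v - e *: g ord0).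
    by rewrite scalerDl scalerBr scalerA opprD addrACA.
  by apply: submodD => //; apply: submodZ.
have [l [cs csP]] := noethR subJ.
have Jcs i : J (cs i).
  apply/csP; exists (fun j => (j == i)%:R).
  rewrite (bigD1 i) //= eqxx scale1r big1 ?addr0 // => j /negPf->.
  by rewrite scale0r.
have /choice[w wP] : forall i, exists v, S v /\ tail (v - cs i *: g ord0).
  by move=> i; have [v] := Jcs i; exists v.
apply: (@fg_submodule_add _ _
  (fun v => exists e : 'I_l -> R, v = \sum_i e i *: w i)
  (fun v => S v /\ tail v)); last 2 first.
- by exists l, w.
- apply: (IHm (g \o lift ord0)) => [|v []//]; split.
    by split; apply: submod0.
  by move=> a u v [Su Tu] [Sv Tv]; split; apply: submodD => //; apply: submodZ.
move=> v; split=> [Sv|[v1 [v2 [-> [e ->] [Sv2 _]]]]]; last first.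
  apply: submodD => //; apply: submod_sum => // i.
  by apply: submodZ => //; case: (wP i).
have [c vE] := Sg v Sv.
have /csP[e eE] : J (c ord0).
  exists v => //; exists (fun k => c (lift ord0 k)).
  by rewrite vE big_ord_recl addrC addKr.
exists (\sum_i e i *: w i), (v - \sum_i e i *: w i); split.
- by rewrite addrC subrK.
- by exists e.
have Sw : S (\sum_i e i *: w i).
  by apply: submod_sum => // i; apply: submodZ => //; case: (wP i).
split; first exact: submodB.
have -> : v - \sum_i e i *: w i = \sum_k c (lift ord0 k) *: g (lift ord0 k)
          - \sum_i e i *: (w i - cs i *: g ord0).
  rewrite (eq_bigr _ (fun i _ => scalerBr _ _ _)) sumrB opprB addrA.
  congr (_ - _); rewrite {1}vE big_ord_recl addrC; congr (_ + _).
  by rewrite eE scaler_suml; apply: eq_bigr => i _; rewrite scalerA.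
apply: submodB => //; first by exists (fun k => c (lift ord0 k)).
by apply: submod_sum => // i; apply: submodZ => //; case: (wP i).
Qed.

(** The kernel of the map R^m -> V given by e is finitely generated; the rows of
    C are its generators. *)
Lemma relations (V : lmodType R) m (e : 'I_m -> V) :
  exists l (C : 'M[R]_(l, m)), (forall a, mxact C e a = 0) /\
    forall k (X : 'M[R]_(k, m)), (forall a, mxact X e a = 0) ->
      exists Y, X = Y *m C.
Proof.
pose S (x : 'rV[R]_m) := mxact x e ord0 = 0.
have subS : is_submodule S.
  split; first exact: mxact0l.
  by move=> a u v Su Sv; rewrite /S mxactDl mxactZl Su Sv scaler0 addr0.
have [|l [g gP]] :=
  @noetherian_submodule 'rV[R]_m m (fun k => delta_mx ord0 k) S subS.
  by move=> v _; exists (v ord0); rewrite {1}[v]row_sum_delta.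
have actE k (X : 'M[R]_(k, m)) a : mxact X e a = mxact (row a X) e ord0.
  by apply: eq_bigr => b _; rewrite mxE.
exists l, (\matrix_i g i); split=> [a|k X X0].
  rewrite actE rowK; apply/gP; exists (fun i => (i == a)%:R).
  rewrite (bigD1 a) //= eqxx scale1r big1 ?addr0 // => j /negPf->.
  by rewrite scale0r.
have /choice[c cE] : forall a, exists c, row a X = \sum_i c i *: g i.
  by move=> a; apply/gP; rewrite /S -actE.
exists (\matrix_(a, i) c a i); apply/row_matrixP => a.
rewrite row_mul mulmx_sum_row cE; apply: eq_bigr => i _.
by rewrite !mxE rowK.
Qed.

Lemma syzygies m n (B : 'M[R]_(m, n)) :
  exists l (C : 'M[R]_(l, m)), C *m B = 0 /\
    forall k (X : 'M[R]_(k, m)), X *m B = 0 -> exists Y, X = Y *m C.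
Proof.
have [l [C [C0 CP]]] := relations (fun b => row b B).
exists l, C; split=> [|k X XB0].
  by apply/row_matrixP => a; rewrite -mxact_row C0 row0.
by apply: CP => a; rewrite mxact_row XB0 row0.
Qed.

End Noetherian.

(** * Resolutions by finite free modules *)

(** A resolution of the cokernel of [fdiff 0] by finite free modules. Matrices
    act on row vectors, so rows index the source. *)
Record free_complex (R : comNzRingType) := FreeComplex {
  frank : nat -> nat;
  fdiff : forall k, 'M[R]_(frank k.+1, frank k);
  fdiffK : forall k, fdiff k.+1 *m fdiff k = 0;
  fexact : forall k m (X : 'M[R]_(m, frank k.+1)),
    X *m fdiff k = 0 -> exists Y, X = Y *m fdiff k.+1 }.

Section FreeResolution.
Variables (R : comNzRingType) (noethR : noetherian R).

Record sized_mx := SizedMx {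
  srow : nat; scol : nat; sval_mx : 'M[R]_(srow, scol) }.

Definition syzygy_mx (B : sized_mx) : sized_mx :=
  let l := cid (syzygies noethR (sval_mx B)) in
  @SizedMx (sval l) (srow B) (sval (cid (svalP l))).

Lemma syzygy_mxP (B : sized_mx) :
  sval_mx (syzygy_mx B) *m sval_mx B = 0 /\
  forall k (X : 'M_(k, srow B)), X *m sval_mx B = 0 ->
    exists Y, X = Y *m sval_mx (syzygy_mx B).
Proof. by rewrite /syzygy_mx /=; case: (cid _) => l hl /=; case: (cid _). Qed.

Fixpoint iter_syzygy (B : sized_mx) (k : nat) : sized_mx :=
  if k is k'.+1 then syzygy_mx (iter_syzygy B k') else B.

(** The complex is a function of its first matrix, so that its first two ranks
    are the dimensions of B by computation. *)
Definition syzygy_complex m n (B : 'M[R]_(m, n)) : free_complex R :=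
  @FreeComplex R (fun k => scol (iter_syzygy (SizedMx B) k))
    (fun k => sval_mx (iter_syzygy (SizedMx B) k))
    (fun k => (syzygy_mxP _).1) (fun k => (syzygy_mxP _).2).

End FreeResolution.

(** * Clearing denominators in a finitely generated module *)

Section IndependentCocycles.
Variable R : idomainType.

(** A finitely generated module Z/B over a domain contains a free submodule
    whose quotient is torsion: a maximal family of generators independent
    modulo B. *)
Lemma maximal_independent (V : lmodType R) (B Z : V -> Prop) m (g : 'I_m -> V) :
  is_submodule B -> (forall k, Z (g k)) ->
  exists l (z : 'I_l -> V) (r : R),
    [/\ r != 0, forall i, Z (z i),
        forall c : 'I_l -> R, B (\sum_i c i *: z i) -> forall i, c i = 0 &
        forall k, exists c : 'I_l -> R, B (r *: g k - \sum_i c i *: z i)].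
Proof.
move=> subB; elim: m g => [|m IHm] g Zg.
  by exists 0%N, (fun=> 0), 1; split=> [|[]|? ? []|[]] //; apply: oner_neq0.
have [l [z [r [r0 Zz ind gen]]]] := IHm (g \o lift ord0) (fun k => Zg _).
have [[c [e [c0 Bce]]]|nodep] :=
  EM (exists c (e : 'I_l -> R), c != 0 /\ B (c *: g ord0 - \sum_i e i *: z i)).
  exists l, z, (r * c); split=> // [|k]; first by rewrite mulf_neq0.
  have [k' ->|->] := unliftP ord0 k.
    have [f Bf] := gen k'; exists (fun i => c * f i).
    have := submodZ subB c Bf; rewrite scalerBr scalerA mulrC scaler_sumr /=.
    by under eq_bigr do rewrite scalerA.
  exists (fun i => r * e i).
  have := submodZ subB r Bce; rewrite scalerBr scalerA scaler_sumr /=.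
  by under eq_bigr do rewrite scalerA.
pose z' (t : 'I_l.+1) := if unlift ord0 t is Some i then z i else g ord0.
have z0 : z' ord0 = g ord0 by rewrite /z' unlift_none.
have zl i : z' (lift ord0 i) = z i by rewrite /z' liftK.
clearbody z'.
exists l.+1, z', r; split=> // [t|c|k].
- by case: (unliftP ord0 t) => [i|] ->; rewrite ?z0 ?zl.
- rewrite big_ord_recl z0 (eq_bigr _ (fun i _ => congr1 _ (zl i))) => Bc.
  have c0 : c ord0 = 0.
    apply: contrapT => /eqP c0; apply: nodep.
    exists (c ord0), (fun i => - c (lift ord0 i)); split=> //.
    by under eq_bigr do rewrite scaleNr; rewrite sumrN opprK.
  move: Bc; rewrite c0 scale0r add0r => /ind cl t.
  by case: (unliftP ord0 t) => [i|] ->.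
have [k' ->|->] := unliftP ord0 k.
  have [f Bf] := gen k'.
  exists (fun t => if unlift ord0 t is Some i then f i else 0).
  rewrite big_ord_recl unlift_none scale0r add0r.
  by under eq_bigr do rewrite liftK zl.
exists (fun t => if unlift ord0 t is Some i then 0 else r).
rewrite big_ord_recl unlift_none z0 big1 => [|i _]; last first.
  by rewrite liftK scale0r.
by rewrite addr0 subrr; apply: submod0.
Qed.

End IndependentCocycles.

(** * Cocycles and coboundaries *)

Lemma transport_irr (R : comNzRingType) (Y : complex R) (i : int) (e : i = i)
    (y : Y i) : transport e y = y.
Proof. by rewrite (eq_irrelevance e (erefl i)). Qed.

Lemma is_submodule_coboundary (R : comNzRingType) (X : complex R) (i : int) :
  is_submodule (@coboundary R X i).
Proof.
split.
  have [j e] : exists j, j + 1 = i by exists (i - 1); rewrite subrK.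
  by exists j, e, 0; rewrite linear0.
move=> a u v [j [e [w ->]]] [j' [e' [w' ->]]].
have jj' : j = j' by apply: (addIr 1); rewrite e e'.
subst j'; rewrite (eq_irrelevance e' e).
by exists j, e, (a *: w + w'); rewrite linearP.
Qed.

Lemma cocycleP (R : comNzRingType) (X : complex R) (i i' : int) (e : i + 1 = i')
    (x : X i) : cocycle x <-> diff X e x = 0.
Proof. by case: _ / e. Qed.

Lemma coboundaryP (R : comNzRingType) (X : complex R) (i i' : int)
    (e : i + 1 = i') (x : X i') :
  coboundary x -> exists w, x = diff X e w.
Proof.
case=> j [e' [w ->]]; have jj' : j = i by apply: (addIr 1); rewrite e e'.
by subst j; rewrite (eq_irrelevance e' e); exists w.
Qed.

Lemma is_submodule_cocycle (R : comNzRingType) (X : complex R) (i : int) :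
  is_submodule (@cocycle R X i).
Proof.
split; first exact: linear0.
by move=> a u v; rewrite /cocycle linearP => -> ->; rewrite scaler0 addr0.
Qed.

(** * Maps from truncated dual complexes, and their homotopies *)

Section Families.
Variables (R : comNzRingType) (F : free_complex R).

Local Notation p := (frank F).

(** The differential P^j -> P^(j+1) of the complex dual to F. *)
Definition dualmx (j : nat) : 'M[R]_(p j, p j.+1) := (fdiff F j)^T.
Local Notation A := dualmx.

Lemma dualmxK j : A j *m A j.+1 = 0.
Proof. by rewrite -trmx_mul fdiffK trmx0. Qed.

Lemma dualmx_exact j m (C : 'M[R]_(p j.+1, m)) :
  A j *m C = 0 -> exists D, C = A j.+1 *m D.
Proof.
move/(congr1 trmx); rewrite trmx_mul trmxK trmx0 => /fexact[D /(congr1 trmx)].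
by rewrite trmxK trmx_mul => ->; exists D^T.
Qed.

Lemma dualact2 (V : lmodType R) j (y : 'I_(p j.+2) -> V) a :
  mxact (A j) (mxact (A j.+1) y) a = 0.
Proof. by rewrite mxact_mul dualmxK mxact0l. Qed.

(** Maps P^j -> X^i for all j and i at once, given on bases. Taking all degrees
    together avoids casts between the degrees of X, and makes shifts of X act
    by reindexing. *)
Definition fam (X : complex R) := forall (j : nat) (i : int), 'I_(p j) -> X i.

Section OneComplex.
Variable X : complex R.
Implicit Types (f g h s : fam X) (k : nat).

Definition zerof : fam X := fun _ _ _ => 0.
Definition scalef (c : R) f : fam X := fun j i a => c *: f j i a.

(** A sum of chain maps, one of each degree, from the truncation P^{>=k} to X.
    Values at j < k are unconstrained, so that f also represents its own
    restrictions to shorter truncations. *)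
Definition chain k f := forall j i i' (e : i + 1 = i') a, (k <= j)%N ->
  diff X e (f j i a) = mxact (A j) (f j.+1 i') a.

(** Homotopy on P^{>=k}; the term s k is included, so the homotopy on P^{>=k}
    does not involve P^(k-1). *)
Definition htp k f g := exists s : fam X,
  forall j i i' (e : i + 1 = i') a, (k <= j)%N ->
    f j i' a = g j i' a + (diff X e (s j i a) + mxact (A j) (s j.+1 i') a).

Lemma chain_zero k : chain k zerof.
Proof. by move=> j i i' e a _; rewrite linear0 mxact0. Qed.

Lemma chain_scale k c f : chain k f -> chain k (scalef c f).
Proof. by move=> hf j i i' e a kj; rewrite linearZ mxactZ hf. Qed.

Lemma chain_mono k k' f : (k <= k')%N -> chain k f -> chain k' f.
Proof. by move=> kk hf j i i' e a kj; apply: hf; apply: leq_trans kj. Qed.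

Lemma htp_refl k f : htp k f f.
Proof. by exists zerof => j i i' e a _; rewrite linear0 mxact0 !addr0. Qed.

Lemma htp_sym k f g : htp k f g -> htp k g f.
Proof.
case=> s hs; exists (scalef (-1) s) => j i i' e a kj.
by rewrite /scalef (hs _ _ _ e) // linearZ mxactZ /= !scaleN1r -opprD addrK.
Qed.

Lemma htp_trans k g f h : htp k f g -> htp k g h -> htp k f h.
Proof.
case=> s hs [t ht]; exists (fun j i a => s j i a + t j i a) => j i i' e a kj.
rewrite (hs _ _ _ e) // (ht _ _ _ e) // linearD mxactD -addrA; congr (_ + _).
by rewrite addrC addrACA.
Qed.

Lemma htp_scale k c f g : htp k f g -> htp k (scalef c f) (scalef c g).
Proof.
case=> s hs; exists (scalef c s) => j i i' e a kj.
by rewrite linearZ mxactZ -!scalerDr -hs.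
Qed.

Lemma htp_mono k k' f g : (k <= k')%N -> htp k f g -> htp k' f g.
Proof.
by move=> kk [s hs]; exists s => j i i' e a kj; apply: hs; apply: leq_trans kj.
Qed.

Lemma htp_ext k f g : (forall j i a, f j i a = g j i a) -> htp k f g.
Proof.
move=> fg; have [s hs] := htp_refl k g.
by exists s => j i i' e a kj; rewrite fg; apply: hs.
Qed.

(** The coghost property: c annihilates the restriction maps
    [P^{>=k}, X] -> [P^{>=k+n}, X], for all k. *)
Definition kills (n : nat) (c : R) :=
  forall k f, chain k f -> htp (k + n) (scalef c f) zerof.

Lemma kills_mono n n' c : (n <= n')%N -> kills n c -> kills n' c.
Proof.
by move=> nn' h k f /h; apply: htp_mono; rewrite leq_add2l.
Qed.

(** The hypothesis [step] is the obstruction-theoretic step in a single degree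
    i of X: a family g of cocycles which becomes a coboundary on P^{>=k} after
    composition with the differential of P is, up to the multiplier rho i and
    a coboundary, of the form t o d with t cocycle-valued. For acyclic X
    one may take t = 0; for general X, t absorbs the cohomology classes. *)
Section Levels.
Variables (k k' : nat) (rho : int -> R).
Hypothesis kk' : (k <= k')%N.
Hypothesis step : forall i (g : forall j, 'I_(p j) -> X i),
  (forall j x, (k' <= j)%N -> cocycle (g j x)) ->
  (forall j x, (k <= j)%N -> coboundary (mxact (A j) (g j.+1) x)) ->
  exists t : forall j, 'I_(p j) -> X i, (forall j x, cocycle (t j x)) /\
    forall j x, (k' <= j)%N ->
      coboundary (rho i *: g j x - mxact (A j) (t j.+1) x).

Definition partial_null (c : R) f (i0 : int) := exists s : fam X,
  forall j i i' (e : i + 1 = i') a, (k' <= j)%N -> i0 < i' ->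
    c *: f j i' a = diff X e (s j i a) + mxact (A j) (s j.+1 i') a.

(** The defect of the given homotopy in degree i0 is a family of cocycles to
    which [step] applies. It provides the next term w of the homotopy, and
    modifies the term in degree i0 by the family t; since t consists of
    cocycles, the equation already solved one degree higher is not
    disturbed. *)
Lemma partial_null_step c f i0 : chain k f -> partial_null c f i0 ->
  partial_null (rho i0 * c) f (i0 - 1).
Proof.
move=> hf [s hs].
pose g j (a : 'I_(p j)) := c *: f j i0 a - mxact (A j) (s j.+1 i0) a.
have [||t [tZ tB]] := step (g := g).
- move=> j x kj.
  rewrite /cocycle linearB linearZ /= (hf _ _ _ (erefl _)) ?(leq_trans kk') //.
  rewrite (linear_mxact (diff X _)) -mxactZ -mxactB.
  have E b : c *: f j.+1 (i0 + 1) b - diff X erefl (s j.+1 i0 b)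
           = mxact (A j.+1) (s j.+2 (i0 + 1)) b.
    rewrite (hs _ _ _ (erefl (i0 + 1))) ?(leq_trans kj) ?ltzD1 //=.
    by rewrite [_ + mxact _ _ _]addrC addrK.
  rewrite (eq_mxact _ _ E).
  exact: dualact2.
- move=> j x kj; rewrite mxactB dualact2 subr0 mxactZ.
  have e : i0 - 1 + 1 = i0 by rewrite subrK.
  rewrite -(hf _ _ _ e) //.
  apply: submodZ; first exact: is_submodule_coboundary.
  by exists (i0 - 1), e, (f j (i0 - 1) x).
have /choice[w hw] : forall ji : {j : nat & 'I_(p j)}, exists w : forall i, X i,
    forall i (e : i + 1 = i0), (k' <= tag ji)%N ->
    rho i0 *: g _ (tagged ji) - mxact (A _) (t (tag ji).+1) (tagged ji)
      = diff X e (w i).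
  case=> j x /=; have [kj|] := leqP k' j; last by exists (fun=> 0).
  have e : i0 - 1 + 1 = i0 by rewrite subrK.
  have [w wE] := coboundaryP e (tB j x kj).
  exists (fun i => if eqP is ReflectT e'
                   then transport (e' : i0 - 1 = i) w else 0).
  move=> i e' _; rewrite wE.
  have ei : i0 - 1 = i by apply: (addIr 1); rewrite e e'.
  subst i; rewrite (eq_irrelevance e e').
  by case: eqP => // e1; rewrite transport_irr.
(* t, extended by zero to the other degrees of X. *)
pose T j i (x : 'I_(p j)) : X i :=
  if eqP is ReflectT e' then transport (e' : i0 = i) (t j x) else 0.
have T0 j x : T j i0 x = t j x.
  by rewrite /T; case: eqP => // e1; rewrite transport_irr.
have T1 j i x : i0 != i -> T j i x = 0.
  by rewrite /T; case: eqP.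
clearbody T.
exists (fun j i x => if i + 1 == i0 then w (Tagged _ x) i
                     else rho i0 *: s j i x + T j i x).
move=> j i i' e x kj li'.
have [ei'|ni'] := eqVneq i' i0.
  move: ei' e li' => -> e _; rewrite e eqxx.
  move: (hw (Tagged _ x) i e kj) => /= <-.
  have /negPf-> : i0 + 1 != i0 by lia.
  under [X in _ = _ + X]eq_mxact => b do rewrite T0.
  by rewrite mxactD mxactZ /g scalerBr scalerA -[_ - _ - _]addrA -opprD subrK.
have li0 : i0 < i' by lia.
have /negPf-> : i + 1 != i0 by rewrite e.
have /negPf-> : i' + 1 != i0 by lia.
under [X in _ = _ + X]eq_mxact => b do rewrite T1 1?eq_sym // addr0.
rewrite mxactZ linearD linearZ /=.
have -> : diff X e (T j i x) = 0.
  have [ei|ni] := eqVneq i0 i; last by rewrite T1 // linear0.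
  by subst i; rewrite T0; apply/cocycleP.
by rewrite addr0 -scalerDr -(hs _ _ _ e) // scalerA.
Qed.

(** A null-homotopy is built one degree of X at a time, downwards from the top
    degree b. *)
Lemma null_by_levels (a b : int) f :
  (forall i, (i < a) || (b < i) -> zero_module (X i)) -> chain k f ->
  htp k' (scalef (\prod_(m < `|b - a|.+1) rho (b - m%:Z)) f) zerof.
Proof.
move=> X0 hf.
have level m : partial_null (\prod_(l < m) rho (b - l%:Z)) f (b - m%:Z).
  elim: m => [|m IHm].
    exists zerof => j i i' e x _; rewrite subr0 => bi'.
    by rewrite (X0 i' _ (_ *: _)) ?bi' ?orbT // linear0 mxact0 addr0.
  have -> : b - m.+1%:Z = b - m%:Z - 1 by lia.
  by rewrite big_ord_recr /= mulrC; apply: partial_null_step.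
have [s hs] := level `|b - a|.+1.
exists s => j i i' e x kj; rewrite /zerof add0r.
have [lo|hi] := boolP (b - `|b - a|.+1%:Z < i'); first exact: hs.
have z : zero_module (X i') by apply: X0; lia.
by rewrite [LHS]z [RHS]z.
Qed.

End Levels.

End OneComplex.
End Families.

(** * Shifts, direct sums and cones *)

Section Functoriality.
Variables (R : comNzRingType) (F : free_complex R).

Local Notation p := (frank F).
Local Notation A := (dualmx F).
Local Notation fam := (fam F).

Lemma htp_acyclic (X : complex R) k (f : fam X) :
  bounded X -> (forall i (x : X i), cocycle x -> coboundary x) ->
  chain k f -> htp k f (@zerof _ F X).
Proof.
case=> a [b X0] acyc hf.
have := @null_by_levels _ F X k k (fun=> 1) (leqnn k) _ a b f X0 hf.
rewrite big1 // => h; apply: (htp_trans (g := scalef 1 f)).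
  by apply: htp_ext => j i x; rewrite /scalef scale1r.
apply: h => i g gZ gB; exists (fun _ _ => 0); split=> [j x|j x kj].
  exact: submod0 (is_submodule_cocycle _ _).
by rewrite scale1r mxact0 subr0; apply/acyc/gZ.
Qed.

Section Shift.
Variables (t : int) (X : complex R).

(** The sign turns the differential of the shift, which is (-1)^t d, back
    into d: a chain map of degree m into the shift becomes one of degree m + t
    into X. *)
Definition unshift (f : fam (shift t X)) : fam X := fun j i a =>
  (-1) ^+ (`|t| * j) *: transport (subrK t i) (f j (i - t) a : X (i - t + t)).
Arguments unshift f j i a : clear implicits.

Lemma unshiftE (f : fam (shift t X)) j i i' (e : i + t = i') a :
  unshift f j i' a = (-1) ^+ (`|t| * j) *: transport e (f j i a : X (i + t)).
Proof.
have ei : i = i' - t by rewrite -e addrK.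
by subst i; rewrite /unshift (eq_irrelevance e (subrK t i')).
Qed.

Lemma chain_unshift k f : chain k f -> chain k (unshift f).
Proof.
move=> hf j i i' e a kj.
have [i0 ei] : exists i0, i = i0 + t by exists (i - t); rewrite subrK.
subst i; have e' : i0 + 1 + t = i' by rewrite addrAC.
case: i' / e' e => e; rewrite (unshiftE _ (erefl (i0 + t))) linearZ /=.
rewrite (eq_mxact _ _ (fun b => unshiftE f (erefl (i0 + 1 + t)) b)).
rewrite mxactZ mulnS exprD mulrC -scalerA; congr (_ *: _).
have /= := hf j i0 (i0 + 1) erefl a kj; rewrite /shift_diff.
rewrite (eq_irrelevance (shift_eq t erefl) e) => h.
transitivity ((-1) ^+ `|t| *: ((-1) ^+ `|t| *: diff X e (f j i0 a)) : X _).
  by rewrite scalerA -exprMn mulrNN mulr1 expr1n scale1r.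
by rewrite h.
Qed.

Lemma kills_shift n c : kills F X n c -> kills F (shift t X) n c.
Proof.
move=> h k f /chain_unshift/h[s hs].
exists (fun j i a => (-1) ^+ (`|t| * j.+1) *: s j (i + t) a).
move=> j i i' e a kj; have := hs j _ _ (shift_eq t e) a kj.
rewrite /zerof /scalef !add0r (unshiftE _ (erefl (i' + t))) /= => h1.
have sK m (v : X (i' + t)) : (-1) ^+ m *: ((-1) ^+ m *: v) = v.
  by rewrite scalerA -exprMn mulrNN mulr1 expr1n scale1r.
have h2 : (-1) ^+ (`|t| * j) *: (c *: f j i' a : X (i' + t)) =
    diff X (shift_eq t e) (s j (i + t) a) + mxact (A j) (s j.+1 (i' + t)) a.
  by rewrite scalerA mulrC -scalerA.
rewrite -[LHS](sK (`|t| * j)%N) [X in _ *: X]h2.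
rewrite scalerDr (mxactZ (V := X (i' + t))) /shift_diff.
rewrite linearZ scalerA -exprD /=.
rewrite !mulnS addnA.
by have -> (m : nat) : (-1) ^+ (`|t| + `|t| + m) = (-1) ^+ m :> R
  by rewrite exprD addnn -signr_odd odd_double mul1r.
Qed.

End Shift.
Arguments unshift [t X] f j i a.

Lemma kills_dsum (X Y : complex R) n c :
  kills F X n c -> kills F Y n c -> kills F (dsum X Y) n c.
Proof.
move=> hX hY k f hf.
have [|s hs] := hX k (fun j i a => (f j i a).1).
  move=> j i i' e a kj; have := congr1 fst (hf j i i' e a kj) => /= ->.
  exact: (linear_mxact (fst : X i' * Y i' -> X i')).
have [|u hu] := hY k (fun j i a => (f j i a).2).
  move=> j i i' e a kj; have := congr1 snd (hf j i i' e a kj) => /= ->.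
  exact: (linear_mxact (snd : X i' * Y i' -> Y i')).
exists (fun j i a => (s j i a, u j i a)) => j i i' e a kj.
have h1 := hs j i i' e a kj; have h2 := hu j i i' e a kj.
rewrite /scalef /zerof !add0r in h1 h2 *.
rewrite [LHS]surjective_pairing [RHS]surjective_pairing; congr pair.
  apply: etrans h1 _; congr (_ + _).
  by rewrite (linear_mxact (fst : X i' * Y i' -> X i')).
apply: etrans h2 _; congr (_ + _).
by rewrite (linear_mxact (snd : X i' * Y i' -> Y i')).
Qed.

Lemma kills_dsum_left (X Y : complex R) n c :
  kills F (dsum X Y) n c -> kills F X n c.
Proof.
move=> h k f hf.
have [|s hs] := h k (fun j i a => (f j i a, 0)).
  move=> j i i' e a kj; rewrite [LHS]surjective_pairing [RHS]surjective_pairing.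
  congr pair.
    by rewrite (linear_mxact (fst : X i' * Y i' -> X i')) /= -(hf _ _ _ e).
  by rewrite (linear_mxact (snd : X i' * Y i' -> Y i')) /= linear0 mxact0.
exists (fun j i a => (s j i a).1) => j i i' e a kj.
have /(congr1 fst)/= := hs j i i' e a kj.
by rewrite (linear_mxact (fst : X i' * Y i' -> X i')).
Qed.

Lemma kills_zero (X : complex R) n c :
  (forall i, zero_module (X i)) -> kills F X n c.
Proof.
move=> X0 k f _; exists (@zerof _ F X) => j i i' e a _.
by rewrite [LHS]X0 [RHS]X0.
Qed.

Definition push (X Y : complex R) (phi : chmap X Y) (f : fam X) : fam Y :=
  fun j i a => phi i (f j i a).
Arguments push [X Y] phi f j i a.

Section Cone.
Variables (X Y : complex R) (phi : chmap X Y).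

Lemma chain_push k f : chain k f -> chain k (push phi f).
Proof.
by move=> hf j i i' e a kj; rewrite /push -cmapD hf // linear_mxact.
Qed.

Lemma htp_push k f g : htp k f g -> htp k (push phi f) (push phi g).
Proof.
case=> s hs; exists (push phi s) => j i i' e a kj.
by rewrite /push (hs _ _ _ e) // !linearD cmapD linear_mxact.
Qed.

Definition cone_fst (i : int) : {linear cone phi i -> shift 1 X i} :=
  (fst : X (i + 1) * Y i -> X (i + 1)).
Definition cone_snd (i : int) : {linear cone phi i -> Y i} :=
  (snd : X (i + 1) * Y i -> Y i).

(** Exactness of [P, X] -> [P, Y] -> [P, cone phi]: the components of a
    null-homotopy in the cone are a chain map into X, up to shift, and a
    homotopy between its image and c g. *)
Lemma cone_lift k k' c (g : fam Y) :
  chain k g ->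
  htp k' (scalef c (fun j i a => cone_in phi i (g j i a))) (@zerof _ F _) ->
  exists2 f : fam X, chain k' f & htp k' (scalef c g) (push phi f).
Proof.
move=> hg [s hs].
pose x : fam (shift 1 X) := fun j i a => (-1) ^+ j *: cone_fst i (s j i a).
have hx : chain k' x.
  move=> j i i' e a kj; have /(congr1 (@cone_fst i')) := hs j i i' e a kj.
  rewrite /scalef /zerof add0r linearD /= linear_mxact scaler0 => h.
  rewrite /x linearZ mxactZ exprS mulN1r scaleNr -scalerN; congr (_ *: _).
  by apply/eqP; rewrite -addr_eq0 -h.
have xE j i i' (e : i + 1 = i') a :
    unshift x j i' a = transport e (cone_fst i (s j i a)).
  rewrite (unshiftE _ e) /x mul1n; case: i' / e => /=.
  by rewrite scalerA -exprMn mulrNN mulr1 expr1n scale1r.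
exists (unshift x); first exact: chain_unshift.
exists (fun j i a => cone_snd i (s j i a)) => j i i' e a kj.
have /(congr1 (@cone_snd i')) := hs j i i' e a kj.
rewrite /scalef /zerof add0r linearD linear_mxact /= => ->.
rewrite /push (xE _ _ _ e) -addrA; congr (_ + _).
by case: i' / e.
Qed.

Hypothesis qphi : quasi_iso phi.

Lemma cone_acyclic i (z : cone phi i) : cocycle z -> coboundary z.
Proof.
have [i0 ei] : exists i0, i = i0 + 1 by exists (i - 1); rewrite subrK.
subst i; case: z => x y zZ.
have xZ : @cocycle _ X (i0 + 1 + 1) x.
  have := congr1 fst zZ; rewrite /= /shift_diff expr1 scaleN1r => /eqP.
  by rewrite oppr_eq0 => /eqP/cocycleP.
have yE : phi _ x = - diff Y erefl y.
  by apply/eqP; rewrite -addr_eq0; apply/eqP; exact: (congr1 snd zZ).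
have [injp _] := qphi (i0 + 1 + 1).
have [_ surp] := qphi (i0 + 1).
have /coboundaryP-/(_ _ erefl)[w xE] : coboundary x.
  apply: injp => //; rewrite yE -linearN.
  by exists (i0 + 1), erefl, (- y).
have [|x' x'Z] := surp (phi _ w + y).
  by rewrite /cocycle linearD -cmapD -xE yE addNr.
move/coboundaryP => /(_ _ erefl)[v vE].
(* x' - w is chosen so that phi sends it to y up to the coboundary of v. *)
exists i0, erefl, ((x' - w : X (i0 + 1)), - v).
congr pair.
  rewrite /= /shift_diff expr1 scaleN1r (eq_irrelevance (shift_eq _ _) erefl).
  by rewrite linearB x'Z sub0r opprK -xE.
rewrite /= /transport /= linearN -vE linearB.
by rewrite opprB !addrA subrK addrAC subrr add0r.
Qed.

End Cone.

End Functoriality.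

(** * The action of the derived category *)

Section Triangulated.
Variables (R : comNzRingType) (F : free_complex R).

Local Notation p := (frank F).
Local Notation A := (dualmx F).
Local Notation fam := (fam F).
Local Notation zerofam X := (@zerof _ F X).
Arguments push [R F X Y] phi f j i a.
Arguments unshift [R F t X] f j i a.
Arguments scalef [R F X] c f j i a.

Lemma htp_push_scale (X Y : complex R) (phi : chmap X Y) k c (f : fam X) :
  htp k (scalef c (push phi f)) (push phi (scalef c f)).
Proof. by apply: htp_ext => j i a; rewrite /push /scalef linearZ. Qed.

Lemma htp_push_null (X Y : complex R) (phi : chmap X Y) k (f : fam X) :
  htp k f (zerofam X) -> htp k (push phi f) (zerofam Y).
Proof.
move/(htp_push phi) => h; apply: (htp_trans h).
by apply: htp_ext => j i a; rewrite /push linear0.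
Qed.

Lemma htp_scale_null (X : complex R) k c (f : fam X) :
  htp k f (zerofam X) -> htp k (scalef c f) (zerofam X).
Proof.
move/(htp_scale c) => h; apply: (htp_trans h).
by apply: htp_ext => j i a; rewrite /scalef scaler0.
Qed.

(** On P^{>=k+1}, r g vanishes in the cone and so lifts to X; the lift,
    multiplied by c, vanishes n truncation steps further. *)
Lemma kills_cone (X Y : complex R) (phi : chmap X Y) n c r :
  kills F X n c -> kills F (cone phi) 1 r -> kills F Y n.+1 (c * r).
Proof.
move=> hX hC k g hg.
have [f hf gf] := cone_lift hg (hC k _ (chain_push (cone_in phi) hg)).
rewrite addnS -addSn -addn1.
apply: (htp_trans (g := scalef c (scalef r g))).
  by apply: htp_ext => j i a; rewrite /scalef scalerA.
have := htp_mono (leq_addr n _) (htp_scale c gf) => /htp_trans; apply.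
exact/(htp_trans (htp_push_scale _ _ _ _))/htp_push_null/hX.
Qed.

Definition subf (X : complex R) (f g : fam X) : fam X :=
  fun j i a => f j i a - g j i a.
Arguments subf [X] f g j i a.

Lemma chain_sub (X : complex R) k (f g : fam X) :
  chain k f -> chain k g -> chain k (subf f g).
Proof.
move=> hf hg j i i' e a kj.
by rewrite linearB (mxactB (A j) (f j.+1 i')) (hf _ _ _ e) // (hg _ _ _ e).
Qed.

Lemma htp_sub (X : complex R) k (f g : fam X) :
  htp k (subf f g) (zerofam X) <-> htp k f g.
Proof.
split=> -[s hs]; exists s => j i i' e a kj; have := hs _ _ _ e a kj.
  by rewrite /subf /zerof add0r => <-; rewrite addrC subrK.
by rewrite /subf /zerof add0r => ->; rewrite addrC addKr.
Qed.

Section QuasiIso.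
Variables (X Y : dbcomplex R) (phi : chmap X Y).
Hypothesis qphi : quasi_iso phi.

Lemma htp_cone_null k (f : fam (cone phi)) : chain k f -> htp k f (zerofam _).
Proof.
apply: htp_acyclic; first exact: (dbcP (db_cone phi)).1.
by move=> i z; apply: cone_acyclic.
Qed.

Lemma quasi_iso_lift k (g : fam Y) :
  chain k g -> exists2 f : fam X, chain k f & htp k g (push phi f).
Proof.
move=> hg; have := htp_cone_null (chain_push (cone_in phi) hg).
move/(htp_scale_null 1)/(cone_lift hg) => [f hf gf]; exists f => //.
apply: htp_trans gf; apply: htp_ext => j i a; by rewrite /scalef scale1r.
Qed.

(** A chain map f into X together with a null-homotopy of its image in Y is a
    chain map into the shifted cone, which is acyclic. *)
Lemma quasi_iso_null k (f : fam X) :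
  chain k f -> htp k (push phi f) (zerofam Y) -> htp k f (zerofam X).
Proof.
move=> hf [s hs].
pose h : fam (cone phi) := fun j i a =>
  ((-1) ^+ j *: f j (i + 1) a, (-1) ^+ j.+1 *: s j i a).
have [|u hu] := @htp_cone_null k h.
  move=> j i i' e a kj; rewrite [LHS]surjective_pairing [RHS]surjective_pairing.
  have -> : (mxact (A j) (h j.+1 i') a).1
          = mxact (A j) (fun b => (-1) ^+ j.+1 *: f j.+1 (i' + 1) b) a.
    exact: (linear_mxact (@cone_fst _ _ _ phi i')).
  have -> : (mxact (A j) (h j.+1 i') a).2
          = mxact (A j) (fun b => (-1) ^+ j.+2 *: s j.+1 i' b) a.
    exact: (linear_mxact (@cone_snd _ _ _ phi i')).
  rewrite !mxactZ; congr pair.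
    rewrite /= /shift_diff expr1 scaleN1r linearZ /= hf //.
    by rewrite exprS mulN1r scaleNr.
  rewrite /= linearZ /=; case: i' / e; rewrite /transport /=.
  have := hs j i _ erefl a kj; rewrite /push /zerof add0r linearZ /= => ->.
  by rewrite !exprS !mulN1r opprK !scaleNr scalerDr addrAC subrr add0r.
pose u1 : fam (shift 1 X) := fun j i a => cone_fst phi i (u j i a).
exists (fun j i a => - unshift u1 j i a) => j i i' e a kj.
have [i0 ei] : exists i0, i = i0 + 1 by exists (i - 1); rewrite subrK.
subst i; case: i' / e.
have /(congr1 (@cone_fst _ _ _ phi (i0 + 1))) := hu j i0 _ erefl a kj.
rewrite /zerof !add0r linearD linear_mxact /= => h1.
rewrite linearN mxactN (unshiftE _ (erefl (i0 + 1))) linearZ /=.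
rewrite (eq_mxact _ _ (fun b => unshiftE u1 (erefl (i0 + 1 + 1)) b)) mxactZ.
rewrite /transport /= !mul1n exprS mulN1r scaleNr opprK -scalerN -scalerDr.
have -> : - diff X erefl (u1 j i0 a) + mxact (A j) (u1 j.+1 (i0 + 1)) a
         = (-1) ^+ j *: f j (i0 + 1 + 1) a.
  rewrite h1 /shift_diff expr1 scaleN1r.
  by rewrite (eq_irrelevance (shift_eq _ _) erefl).
by rewrite scalerA -exprMn mulrNN mulr1 expr1n scale1r.
Qed.

Lemma quasi_iso_reflect k (f g : fam X) : chain k f -> chain k g ->
  htp k (push phi f) (push phi g) -> htp k f g.
Proof.
move=> hf hg /htp_sub h; apply/htp_sub/quasi_iso_null; first exact: chain_sub.
apply: htp_trans h; apply: htp_ext => j i a.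
by rewrite /subf /push linearB.
Qed.

End QuasiIso.

(** The graph of the map that a morphism of the derived category induces on
    homotopy classes; a formal inverse acts through the converse relation. *)
Fixpoint dact k (X Y : dbcomplex R) (u : dmor X Y) : fam X -> fam Y -> Prop :=
  match u in dmor X Y return fam X -> fam Y -> Prop with
  | dmap _ _ phi => fun f g => htp k (push phi f) g
  | dinv _ _ phi _ => fun f g => htp k f (push phi g)
  | dcomp _ Y _ v u => fun f h =>
      exists2 g : fam Y, chain k g & dact k u f g /\ dact k v g h
  end.

Lemma dact_total k (X Y : dbcomplex R) (u : dmor X Y) (f : fam X) :
  chain k f -> exists2 g, chain k g & dact k u f g.
Proof.
elim: u f => {X Y} [X Y phi f hf|X Y phi q f hf|X Y Z v IHv u IHu f hf].
- by exists (push phi f); [apply: chain_push | apply: htp_refl].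
- exact: quasi_iso_lift.
have [g hg fg] := IHu f hf; have [h hh gh] := IHv g hg.
by exists h => //; exists g.
Qed.

Lemma dact_functional k (X Y : dbcomplex R) (u : dmor X Y) (f f' : fam X)
    (g g' : fam Y) : chain k g -> chain k g' ->
  htp k f f' -> dact k u f g -> dact k u f' g' -> htp k g g'.
Proof.
elim: u f f' g g' => {X Y}
  [X Y phi|X Y phi q|X Y Z v IHv u IHu] f f' g g' hg hg' /=.
- move=> ff fg fg'; apply: htp_trans fg'.
  exact/(htp_trans (htp_sym fg))/htp_push.
- move=> ff fg fg'; apply: (quasi_iso_reflect q) => //.
  exact: htp_trans (htp_sym fg) (htp_trans ff fg').
move=> ff [h hh [fh hg1]] [h' hh' [fh' hg1']].
by apply: IHv hg1 hg1' => //; apply: IHu fh fh'.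
Qed.

Lemma dact_htp k (X Y : dbcomplex R) (u : dmor X Y) (f f' : fam X)
    (g g' : fam Y) : htp k f f' -> htp k g g' -> dact k u f g -> dact k u f' g'.
Proof.
elim: u f f' g g' => {X Y}
  [X Y phi|X Y phi q|X Y Z v IHv u IHu] f f' g g' ff gg /=.
- move=> fg; apply: htp_trans gg; apply: htp_trans fg.
  exact/htp_push/htp_sym.
- move=> fg; apply: (htp_trans (htp_sym ff)); apply: (htp_trans fg).
  exact: htp_push.
case=> h hh [fh hg]; exists h => //; split.
  exact: IHu ff (htp_refl _ _) fh.
exact: IHv (htp_refl _ _) gg hg.
Qed.

Lemma dact_scale k c (X Y : dbcomplex R) (u : dmor X Y) (f : fam X)
    (g : fam Y) : dact k u f g -> dact k u (scalef c f) (scalef c g).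
Proof.
elim: u f g => {X Y} [X Y phi|X Y phi q|X Y Z v IHv u IHu] f g /=.
- by move/(htp_scale c)/(htp_trans _); apply; apply/htp_sym/htp_push_scale.
- by move/(htp_scale c) => h; apply: (htp_trans h); apply: htp_push_scale.
case=> h hh [fh hg]; exists (scalef c h); first exact: chain_scale.
by split; [apply: IHu | apply: IHv].
Qed.

Lemma dact_mono k k' (X Y : dbcomplex R) (u : dmor X Y) (f : fam X)
    (g : fam Y) : (k <= k')%N -> dact k u f g -> dact k' u f g.
Proof.
move=> kk; elim: u f g => {X Y} [X Y phi|X Y phi q|X Y Z v IHv u IHu] f g /=.
- exact: htp_mono.
- exact: htp_mono.
case=> h hh [fh hg]; exists h; first exact: chain_mono hh.
by split; [apply: IHu | apply: IHv].
Qed.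

Lemma dact_zero k (X Y : dbcomplex R) (u : dmor X Y) :
  dact k u (zerofam X) (zerofam Y).
Proof.
elim: u => {X Y} [X Y phi|X Y phi q|X Y Z v IHv u IHu] /=.
- exact/htp_push_null/htp_refl.
- exact/htp_sym/htp_push_null/htp_refl.
by exists (zerofam Y) => //; apply: chain_zero.
Qed.

Lemma dact_deq k (X Y : dbcomplex R) (u v : dmor X Y) : deq u v ->
  forall f g, chain k f -> chain k g -> dact k u f g <-> dact k v f g.
Proof.
elim=> {X Y u v} //.
- by move=> X Y u v _ IH f g hf hg; rewrite IH.
- by move=> X Y u v w _ IH1 _ IH2 f g hf hg; rewrite IH1 // IH2.
- move=> X Y Z v v' u u' _ IHv _ IHu f g hf hg /=.
  by split=> -[h hh [fh hg1]]; exists h => //; split;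
    first [exact/IHu | exact/IHv].
- move=> X Y Z T w v u f g hf hg /=; split.
    by case=> h2 hh2 [[h1 hh1 [? ?]] ?]; exists h1 => //; split=> //; exists h2.
  by case=> h1 hh1 [? [h2 hh2 [? ?]]]; exists h2 => //; split=> //; exists h1.
- move=> X Y u f g hf hg /=; split=> [[h hh [fh hg1]]|fg].
    exact: dact_htp (htp_refl _ _) hg1 fh.
  by exists g => //; split=> //; apply: htp_refl.
- move=> X Y u f g hf hg /=; split=> [[h hh [fh hg1]]|fg].
    exact: dact_htp (htp_sym fh) (htp_refl _ _) hg1.
  by exists f => //; split=> //; apply: htp_refl.
- move=> X Y phi psi e f g hf hg /=.
  have pp : htp k (push phi f) (push psi f).
    by apply: htp_ext => j i a; apply: e.
  by split; apply: htp_trans; first exact: htp_sym.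
- move=> X Y Z psi phi f g hf hg /=; split=> [fg|[h hh [fh hg1]]].
    by exists (push phi f); [apply: chain_push | split=> //; apply: htp_refl].
  exact: htp_trans (htp_push psi fh) hg1.
- move=> X Y phi q f g hf hg /=; split=> [[h hh [fh hg1]]|fg].
    by apply: (quasi_iso_reflect q) => //; apply: htp_trans fh hg1.
  exists (push phi f); first exact: chain_push.
  by split; [apply: htp_refl | apply: htp_push].
move=> X Y phi q f g hf hg /=; split=> [[h hh [fh hg1]]|fg].
  exact: htp_trans fh hg1.
have [h hh fh] := quasi_iso_lift q hf.
by exists h => //; split=> //; apply: htp_trans fg; apply: htp_sym.
Qed.

(** A class in Y is transported to X, annihilated there and transported back;
    the round trip is the identity on classes since equal morphisms have the
    same graph. *)
Lemma kills_iso (X Y : dbcomplex R) n c :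
  isomorphic X Y -> kills F X n c -> kills F Y n c.
Proof.
case=> u [v [_ uvE]] hX k g hg.
have [f hf gf] := dact_total v hg; have [g' hg' fg'] := dact_total u hf.
have gg' : htp k g g'.
  by apply/(dact_deq uvE hg hg'); exists f.
have kk : (k <= k + n)%N by apply: leq_addr.
apply: (htp_trans (htp_scale c (htp_mono kk gg'))).
apply: (dact_functional _ _ (hX k f hf) (dact_scale c (dact_mono kk fg'))
  (dact_zero _ u)); last exact: chain_zero.
exact/chain_scale/(chain_mono kk).
Qed.

Lemma isomorphic_sym (X Y : dbcomplex R) : isomorphic X Y -> isomorphic Y X.
Proof. by case=> u [v [vu uv]]; exists v, u. Qed.

(** By isomorphism invariance it is enough to treat the triangle of a chain
    map. *)
Lemma kills_triangle (X Y Z : dbcomplex R) (u : dmor X Y) (v : dmor Y Z)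
    (w : dmor Z (db_shift 1 X)) n c r : distinguished u v w ->
  kills F X n c -> kills F Z 1 r -> kills F Y n.+1 (c * r).
Proof.
case=> X' [Y' [phi [a [b [d [[aI bI dI] _]]]]]] hX hZ.
apply: (@kills_iso Y'); first by apply: isomorphic_sym; exists b.
apply: (@kills_cone X' Y' phi); first by apply: kills_iso hX; exists a.
by apply: (@kills_iso Z (db_cone phi)) hZ; exists d.
Qed.

Lemma kills_build0 (G X : dbcomplex R) n c :
  kills F G n c -> build0 G X -> kills F X n c.
Proof.
move=> hG [ts]; move/isomorphic_sym/kills_iso; apply.
elim: ts => [|t ts IH] /=; last exact/kills_dsum/IH/kills_shift.
apply: kills_zero => i; rewrite /= /stalk_obj.
by case: eqP => _; apply: zero_mod0.
Qed.

Lemma kills_build (G : dbcomplex R) r n (X : dbcomplex R) :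
  kills F G 1 r -> build G n X -> kills F X n.+1 (r ^+ n.+1).
Proof.
move=> hG; elim: n X => [|n IH] X /=; first exact: kills_build0.
case=> X1 [X0 [u [v [w [tri b0 b1]]]]]; rewrite exprSr.
by apply: kills_triangle tri _ _; [apply: IH | apply: kills_build0 b0].
Qed.

Lemma kills_thick (G : dbcomplex R) r n (X : dbcomplex R) :
  kills F G 1 r -> thick G n X -> kills F X n.+1 (r ^+ n.+1).
Proof.
move=> hG [X' [E [bE /isomorphic_sym iE]]].
exact/(@kills_dsum_left _ _ X X')/(kills_iso iE)/(kills_build hG).
Qed.

End Triangulated.

(** * A multiplier for the generator *)

Section Generator.
Variables (R : idomainType) (noethR : noetherian R) (X : complex R).

(** The z b span a free submodule of the i-th cohomology of X, and r annihilates
    the quotient by it. *)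
Definition cohomology_frame (i : int) (r : R) := r != 0 /\
  exists l (z : 'I_l -> X i),
    [/\ forall b, cocycle (z b),
        forall c : 'I_l -> R, coboundary (\sum_b c b *: z b) ->
          forall b, c b = 0 &
        forall x, cocycle x ->
          exists c : 'I_l -> R, coboundary (r *: x - \sum_b c b *: z b)].

Lemma cohomology_frame_exists i :
  fin_gen (X i) -> exists r, cohomology_frame i r.
Proof.
case=> m [g gP].
have [||q [y yP]] := noetherian_submodule noethR (g := g) (S := @cocycle _ X i).
- exact: is_submodule_cocycle.
- by move=> v _; apply/gP.
have yZ b : cocycle (y b).
  apply/yP; exists (fun a => (a == b)%:R).
  rewrite (bigD1 b) //= eqxx scale1r big1 ?addr0 // => a /negPf->.
  by rewrite scale0r.
have subB := is_submodule_coboundary X i.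
have [l [z [r [r0 zZ ind gen]]]] := maximal_independent subB yZ.
exists r; split=> //; exists l, z; split=> // x /yP[e ->].
have /choice[c cP] := gen.
exists (fun b => \sum_a e a * c a b).
have -> : r *: (\sum_a e a *: y a) - \sum_b (\sum_a e a * c a b) *: z b
        = \sum_a e a *: (r *: y a - \sum_b c a b *: z b).
  under [RHS]eq_bigr do rewrite scalerBr scalerA mulrC -scalerA scaler_sumr.
  rewrite sumrB -scaler_sumr; congr (_ - _).
  rewrite exchange_big /=; apply: eq_bigr => b _; rewrite scaler_suml.
  by apply: eq_bigr => a _; rewrite scalerA.
by apply: submod_sum => // a; apply: submodZ.
Qed.

(** The coefficients on the frame of the cohomology class of r g j form a
    matrix C j. Independence of the frame gives A C = 0, because g is a
    coboundary after composition with A; so C factors through the next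
    differential of P. This uses a term of P^{>=k} just before the j-th one,
    whence the bound j > k. *)
Lemma cohomology_frame_step (F : free_complex R) k i r :
  cohomology_frame i r ->
  forall g : forall j, 'I_(frank F j) -> X i,
  (forall j x, (k.+1 <= j)%N -> cocycle (g j x)) ->
  (forall j x, (k <= j)%N -> coboundary (mxact (dualmx F j) (g j.+1) x)) ->
  exists t : forall j, 'I_(frank F j) -> X i, (forall j x, cocycle (t j x)) /\
    forall j x, (k.+1 <= j)%N ->
      coboundary (r *: g j x - mxact (dualmx F j) (t j.+1) x).
Proof.
case=> _ [l [z [zZ ind gen]]] g gZ gB.
have subB := is_submodule_coboundary X i.
have /choice[c cP] : forall ja : {j : nat & 'I_(frank F j)},
    exists c : 'I_l -> R, (k.+1 <= tag ja)%N ->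
    coboundary (r *: g _ (tagged ja) - \sum_b c b *: z b).
  case=> j a /=; have [kj|] := leqP k.+1 j; last by exists (fun=> 0).
  by have [c cP] := gen _ (gZ j a kj); exists c.
pose C j : 'M[R]_(frank F j, l) :=
  \matrix_(a, b) c (Tagged (fun j => 'I_(frank F j)) a) b.
have CP j a : (k.+1 <= j)%N -> coboundary (r *: g j a - mxact (C j) z a).
  move=> kj; have := cP (Tagged _ a) kj; congr (coboundary (_ - _)).
  by apply: eq_bigr => b _; rewrite mxE.
have DP j : exists D, (k.+1 <= j)%N -> C j = dualmx F j *m D.
  have [|] := leqP k.+1 j; last by exists 0.
  case: j => // j kj.
  have [|D DE] := @dualmx_exact _ F j _ (C j.+1); last by exists D.
  apply/matrixP => a b; rewrite [RHS]mxE.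
  apply: ind b; rewrite -[X in coboundary X]/(mxact (dualmx F j *m C j.+1) z a).
  rewrite -mxact_mul.
  have -> : mxact (dualmx F j) (mxact (C j.+1) z) a
     = r *: mxact (dualmx F j) (g j.+1) a
       - mxact (dualmx F j) (fun b => r *: g j.+1 b - mxact (C j.+1) z b) a.
    by rewrite -mxactZ mxactB opprB addrC subrK.
  apply: submodB => //; first by apply: submodZ => //; apply: gB.
  by apply: submod_mxact => // b; apply: CP.
pose D j := sval (cid (DP j)).
have DE j : (k.+1 <= j)%N -> C j = dualmx F j *m D j := svalP (cid (DP j)).
exists (fun j => if j is j'.+1 then mxact (D j') z else fun=> 0); split.
  case=> [|j] x; first exact: submod0 (is_submodule_cocycle _ _).
  exact: submod_mxact (is_submodule_cocycle _ _) _ _ _ _ _ zZ.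
by move=> j x kj; rewrite mxact_mul -DE //; apply: CP.
Qed.

(** The multiplier is the product of those of the degrees between the bounds
    of X, so it is the same for all F. *)
Lemma kills_generator :
  bounded_fg X -> exists2 r : R, r != 0 & forall F, kills F X 1 r.
Proof.
case=> -[a [b X0]] Xfg.
have /choice[rho rhoP] := fun i => cohomology_frame_exists (Xfg i).
exists (\prod_(m < `|b - a|.+1) rho (b - m%:Z)).
  by apply/prodf_neq0 => m _; case: (rhoP (b - m%:Z)).
move=> F k f hf; rewrite addn1.
apply: (null_by_levels (k := k)) => // i; exact: cohomology_frame_step.
Qed.

End Generator.

(** * From a stalk complex back to its resolution *)

Section Contraction.
Variables (R : comNzRingType) (M : lmodType R) (L : free_complex R).
Local Notation q := (frank L).
Local Notation B := (fdiff L).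
Variable e : 'I_(q 0) -> M.
Hypothesis eB : forall a, mxact (B 0) e a = 0.
Hypothesis e_exact : forall m (X : 'M[R]_(m, q 0)),
  (forall a, mxact X e a = 0) -> exists Y, X = Y *m B 0.
Hypothesis e_span : forall v, exists c : 'rV[R]_(q 0), v = mxact c e ord0.

(** The composite of phi with the differential that leaves L_k, which for k = 0
    is the augmentation e. *)
Definition cycle_mx m k : 'M[R]_(m, q k) -> Prop :=
  if k is k'.+1 then fun phi => phi *m B k' = 0
  else fun phi => forall a, mxact phi e a = 0.

Lemma cycle_mx_boundary m k (Y : 'M[R]_(m, q k.+1)) : cycle_mx (Y *m B k).
Proof.
case: k Y => [|k] Y /=; last by rewrite -mulmxA fdiffK mulmx0.
by move=> a; rewrite -mxact_mul (eq_mxact _ _ eB) mxact0.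
Qed.

Lemma span_mx m (y : 'I_m -> M) :
  exists Y : 'M[R]_(m, q 0), forall a, y a = mxact Y e a.
Proof.
have /choice[c cP] := fun a => e_span (y a).
exists (\matrix_(a, b) c a ord0 b) => a; rewrite cP.
by apply: eq_bigr => b _; rewrite mxE.
Qed.

Variables (F : free_complex R) (d : nat) (r : R).
Local Notation p := (frank F).
Local Notation A := (dualmx F).
Hypothesis killM : kills F (stalk M) d r.

Definition stalk_fam j (y : 'I_(p j) -> M) : fam F (stalk M) := fun j' i =>
  match i return 'I_(p j') -> stalk_obj M i with
  | Posz 0 => fun a => if @eqP _ j' j is ReflectT jj'
                       then y (cast_ord (congr1 p jj') a) else 0
  | _ => fun=> 0
  end.

Lemma stalk_famE j (y : 'I_(p j) -> M) a : stalk_fam y 0 a = y a.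
Proof.
rewrite /stalk_fam; case: eqP => // jj.
by rewrite (eq_irrelevance jj erefl) /= cast_ord_id.
Qed.

Lemma chain_stalk_fam j (y : 'I_(p j.+1) -> M) :
  (forall a, mxact (A j) y a = 0) -> chain 0 (stalk_fam y).
Proof.
move=> y0 j' i [[|i']|i'] ei a _ /=; rewrite ?mxact0 //.
apply/esym; have [jj'|jj'] := eqVneq j' j; last first.
  rewrite (@eq_mxact _ _ _ _ _ _ (fun=> 0)) ?mxact0 // => b.
  by case: eqP => // jE; case: (negP jj'); rewrite -eqSS; apply/eqP.
subst j'; rewrite -[RHS](y0 a); apply: eq_mxact => b.
exact: (stalk_famE y).
Qed.

(** Induction on k, in which phi is the component P^(j+1) -> L_k of a partial
    chain map P -> L. For k > 0, exactness of the dual of P extends it by a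
    component psi : P^(j+2) -> L_(k-1), and exactness of L lifts the
    contraction of r psi to one of r phi. For k = 0, composing with e gives a
    chain map from P to the stalk M, which is null-homotopic on P^{>=j+1} after
    multiplication by r. *)
Lemma stalk_contraction k j (phi : 'M[R]_(p j.+1, q k)) :
  (k + j.+1)%N = d -> cycle_mx (A j *m phi) ->
  exists h h', r *: phi = h *m B k + A j.+1 *m h'.
Proof.
elim: k j phi => [|k IHk] j phi kd phi0.
  have phi0' a : mxact (A j) (mxact phi e) a = 0 by rewrite mxact_mul.
  have [s hs] := killM (chain_stalk_fam phi0').
  (* The differential of the stalk vanishes, so the homotopy is a factorization
     through P^(j+2). *)
  have sE a : r *: mxact phi e a = mxact (A j.+1) (s j.+2 0 : _ -> M) a.
    have := hs j.+1 (-1) 0 erefl a; rewrite -kd !add0n leqnn => /(_ isT).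
    by rewrite /zerof /scalef !add0r stalk_famE.
  have [h' hE] := span_mx (s j.+2 0 : _ -> M).
  have [a|h E] := e_exact (X := r *: phi - A j.+1 *m h').
    rewrite mxactDl -scaleN1r !mxactZl sE -mxact_mul -(eq_mxact _ _ hE).
    by rewrite scaleN1r subrr.
  by exists h, h'; rewrite -E subrK.
have phiB : A j *m (phi *m B k) = 0 by rewrite mulmxA.
have [psi psiE] := dualmx_exact phiB.
have kd' : (k + j.+2)%N = d by rewrite -kd addnS.
have psi0 : cycle_mx (A j.+1 *m psi) by rewrite -psiE; apply: cycle_mx_boundary.
have [h [h' E]] := IHk j.+1 psi kd' psi0.
have [|g gE] := fexact (f := L) (k := k) (X := r *: phi - A j.+1 *m h).
  rewrite mulmxBl -scalemxAl psiE scalemxAr E mulmxDr mulmxA.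
  by rewrite [X in _ + X - _]mulmxA dualmxK mul0mx addr0 subrr.
by exists g, h; rewrite -gE subrK.
Qed.

End Contraction.

(** * Comparison of projective resolutions *)

Section Image.
Variables (R : comNzRingType) (U V : lmodType R) (d : {linear U -> V}).

(** Images are made into modules so that a projective module lifts maps whose
    values lie in the image of a map that need not be surjective. *)
Definition in_image : {pred V} := fun v => `[<exists y, v = d y>].

Fact in_image_submod : submod_closed in_image.
Proof.
split; first by apply/asboolP; exists 0; rewrite linear0.
move=> a u v /asboolP[x ->] /asboolP[y ->]; apply/asboolP.
by exists (a *: x + y); rewrite linearP.
Qed.
HB.instance Definition _ :=
  GRing.isSubmodClosed.Build R V in_image in_image_submod.

Record image_mod := ImageMod { image_val :> V; _ : image_val \in in_image }.
HB.instance Definition _ := [isSub for image_val].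
HB.instance Definition _ := [Choice of image_mod by <:].
HB.instance Definition _ := [SubChoice_isSubLmodule of image_mod by <:].

End Image.

Lemma linear_bundle (R : comNzRingType) (U V : lmodType R) (f : U -> V) :
  linear f -> exists h : {linear U -> V}, forall x, h x = f x.
Proof.
move=> lf; pose B := GRing.isLinear.Build R U V *:%R f lf.
pose h : {linear U -> V} := HB.pack f B.
by exists h.
Qed.

Lemma projective_lift (R : comNzRingType) (P U V : lmodType R)
    (d : {linear U -> V}) (g : {linear P -> V}) :
  projective P -> (forall x, exists y, g x = d y) ->
  exists h : {linear P -> U}, forall x, g x = d (h x).
Proof.
move=> projP gd.
have dI y : d y \in in_image d by apply/asboolP; exists y.
have gI x : g x \in in_image d by apply/asboolP; apply: gd.
have [|d' d'E] := @linear_bundle R U (image_mod d) (fun y => ImageMod (dI y)).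
  by move=> a x y; apply: val_inj; rewrite /= linearP.
have [|g' g'E] := @linear_bundle R P (image_mod d) (fun y => ImageMod (gI y)).
  by move=> a x y; apply: val_inj; rewrite /= linearP.
have [|h hE] := projP _ _ d' g'.
  move=> v; have /asboolP[y vE] : val v \in in_image d := valP v.
  by exists y; apply: val_inj; rewrite d'E /= -vE.
exists h => x; have := congr1 (@image_val _ _ _ d) (hE x).
by rewrite d'E g'E /= => ->.
Qed.

Lemma projective_rV (R : comNzRingType) n : projective 'rV[R]_n.
Proof.
move=> U V p g surjp.
have /choice[w wP] := fun k : 'I_n => surjp (g (delta_mx 0 k)).
have [|h hE] := @linear_bundle R 'rV[R]_n U (fun x => mxact x w ord0).
  by move=> a x y; rewrite mxactDl mxactZl.
exists h => x; rewrite hE linear_mxact [x in RHS]row_sum_delta linear_sum.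
by apply: eq_bigr => k _; rewrite wP linearZ.
Qed.

Lemma dependent_choice (S : nat -> Type) (Q : forall k, S k -> S k.+1 -> Prop)
    (s0 : S 0) : (forall k s, exists s', Q k s s') ->
  exists f : forall k, S k, f 0 = s0 /\ forall k, Q k (f k) (f k.+1).
Proof.
move=> H; pose next k s := sval (cid (H k s)).
exists (nat_rect S s0 next); split=> // k.
exact: (svalP (cid (H k _))).
Qed.

Section Comparison.
Variables (R : comNzRingType) (M : lmodType R) (T L : proj_resolution M).

Lemma res_diffK k (x : T k.+2) : res_diff T k (res_diff T k.+1 x) = 0.
Proof. by apply/res_exact; exists x. Qed.

Lemma comparison_map : exists u : forall k, {linear T k -> L k},
  (forall x, res_aug L (u 0 x) = res_aug T x) /\
  forall k x, u k (res_diff T k x) = res_diff L k (u k.+1 x).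
Proof.
(* A component is carried together with the condition that it extends one step
   further. *)
pose S k := {u : {linear T k -> L k} |
  forall x, exists y, u (res_diff T k x) = res_diff L k y}.
have [|u0 u0E] := projective_lift (d := res_aug L) (g := res_aug T)
  (@res_projective _ _ T 0).
  by move=> x; have [y yE] := res_aug_surj L (res_aug T x); exists y.
have u0S x : exists y, u0 (res_diff T 0 x) = res_diff L 0 y.
  by apply/res_exact0; rewrite -u0E; apply/res_exact0; exists x.
have [k s|u [u0' uE]] := @dependent_choice S
  (fun k s s' => forall x, sval s (res_diff T k x) = res_diff L k (sval s' x))
  (exist _ u0 u0S).
  have [h hE] := projective_lift (g := sval s \o res_diff T k)
    (d := res_diff L k) (@res_projective _ _ T k.+1) (svalP s).
  have hS x : exists y, h (res_diff T k.+1 x) = res_diff L k.+1 y.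
    by apply/res_exact; rewrite -hE /= res_diffK linear0.
  by exists (exist _ h hS) => x; rewrite /= -hE.
exists (fun k => sval (u k)); split=> // x; by rewrite u0' -u0E.
Qed.

Lemma comparison_homotopy (w : forall k, {linear T k -> L k}) :
  (forall x, res_aug L (w 0 x) = 0) ->
  (forall k x, w k (res_diff T k x) = res_diff L k (w k.+1 x)) ->
  forall k, exists (s : {linear T k.+1 -> L k.+2})
                   (s' : {linear T k -> L k.+1}),
    forall x, w k.+1 x = res_diff L k.+1 (s x) + s' (res_diff T k x).
Proof.
move=> w0 wE.
have step k (s' : {linear T k -> L k.+1}) :
    (forall x, w k (res_diff T k x) = res_diff L k (s' (res_diff T k x))) ->
    exists s : {linear T k.+1 -> L k.+2},
      forall x, w k.+1 x = res_diff L k.+1 (s x) + s' (res_diff T k x).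
  move=> s'E.
  have [|g gE] := @linear_bundle R (T k.+1) (L k.+1)
    (fun x => w k.+1 x - s' (res_diff T k x)).
    move=> a x y; rewrite !(linearP (w _), linearP (res_diff _ _), linearP s').
    by rewrite scalerBr opprD addrACA.
  have [|s sE] := projective_lift (g := g) (d := res_diff L k.+1)
    (@res_projective _ _ T k.+1).
    move=> x; rewrite gE; apply/res_exact.
    by rewrite linearB /= -wE s'E subrr.
  by exists s => x; rewrite -sE gE subrK.
have H k : exists s' : {linear T k -> L k.+1},
    forall x, w k (res_diff T k x) = res_diff L k (s' (res_diff T k x)).
  elim: k => [|k [s' s'E]].
    have [|s sE] := projective_lift (g := w 0) (d := res_diff L 0)
      (@res_projective _ _ T 0).
      by move=> x; apply/res_exact0.
    by exists s => x; rewrite sE.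
  have [s sE] := step k s' s'E.
  by exists s => x; rewrite sE res_diffK linear0 addr0.
move=> k; have [s' s'E] := H k; have [s sE] := step k s' s'E.
by exists s, s'.
Qed.

End Comparison.

(** * Annihilators of Ext *)

Section ExtAnnihilator.
Variables (R : comNzRingType) (M : lmodType R) (L : free_complex R).
Local Notation q := (frank L).
Local Notation B := (fdiff L).
Variable e : 'I_(q 0) -> M.
Hypothesis eB : forall a, mxact (B 0) e a = 0.
Hypothesis e_exact : forall m (X : 'M[R]_(m, q 0)),
  (forall a, mxact X e a = 0) -> exists Y, X = Y *m B 0.
Hypothesis e_span : forall v, exists c : 'rV[R]_(q 0), v = mxact c e ord0.

(** The matrices of L as a projective resolution; the maps toL and ofL identify
    its terms with spaces of row vectors, so that its construction can stay
    hidden. *)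
Lemma free_resolution : exists LR : proj_resolution M,
  exists (toL : forall k, {linear LR k -> 'rV[R]_(q k)})
         (ofL : forall k, {linear 'rV[R]_(q k) -> LR k}),
  [/\ forall k x, ofL k (toL k x) = x,
      forall k x, toL k (res_diff LR k x) = toL k.+1 x *m B k &
      forall k y, ofL k (y *m B k) = res_diff LR k (ofL k.+1 y)].
Proof.
have [|aug augE] := @linear_bundle R 'rV[R]_(q 0) M (fun x => mxact x e ord0).
  by move=> a x y; rewrite mxactDl mxactZl.
have surj m : exists x, aug x = m.
  by have [c cE] := e_span m; exists c; rewrite augE.
have ex0 (x : 'rV_(q 0)) : aug x = 0 <-> exists y, x = mulmxr (B 0) y.
  rewrite augE; split=> [x0|[y ->]].
    by apply: e_exact => a; rewrite ord1.
  by rewrite /= -mxact_mul (eq_mxact _ _ eB) mxact0.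
have ex k (x : 'rV_(q k.+1)) :
    mulmxr (B k) x = 0 <-> exists y, x = mulmxr (B k.+1) y.
  split=> [/fexact //|[y ->]].
  by rewrite /= -mulmxA fdiffK mulmx0.
exists (@ProjResolution R M (fun k => 'rV[R]_(q k))
  (fun k => @projective_rV R _)
  (fun k => mulmxr (B k) : {linear _ -> _}) aug surj ex0 ex).
by exists (fun k => idfun), (fun k => idfun).
Qed.

(** Transporting a cocycle c from T to L and back changes it by a coboundary,
    by the homotopy between v u and the identity; on L, r c factors through
    the differential B d since c vanishes on boundaries. *)
Lemma ann_ext_of_homotopy (T : proj_resolution M) (N : lmodType R) d (r : R)
    (h : 'M[R]_(q d, q d.+1)) (g : 'M[R]_(q d.+1, q d.+2)) :
  r%:M = B d *m h + g *m B d.+1 -> ann_ext T N d.+1 r.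
Proof.
move=> rE c cZ.
have [LR [toL [ofL [toK toD ofD]]]] := free_resolution.
have [u [u_aug uD]] := comparison_map T LR.
have [v [v_aug vD]] := comparison_map LR T.
have wP k : exists w : {linear T k -> T k}, forall x, w x = v k (u k x) - x.
  apply: linear_bundle => a x y; rewrite !(linearP (u _), linearP (v _)).
  by rewrite scalerBr opprD addrACA.
pose w k := sval (cid (wP k)).
have wE k x : w k x = v k (u k x) - x by rewrite /w; case: (cid _).
have [|k x|s [s' sE]] := comparison_homotopy (w := w) _ _ d.
- by move=> x; rewrite wE linearB /= v_aug u_aug subrr.
- by rewrite !wE linearB uD vD.
have [|b bE] := @linear_bundle R (T d) N (fun t =>
  c (v d.+1 (ofL d.+1 (toL d (u d t) *m h))) - r *: c (s' t)).
  move=> a x y; rewrite (linearP (u d)) (linearP (toL d)) mulmxDl -scalemxAl.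
  rewrite (linearP (ofL _)) (linearP (v _)) (linearP s') !(linearP c).
  by rewrite scalerDr scalerBr !scalerA (mulrC r) opprD addrACA.
exists b => x; rewrite bE /=.
have wx : c (v d.+1 (u d.+1 x)) = c x + c (s' (res_diff T d x)).
  have := congr1 c (sE x); rewrite wE linearB linearD cZ add0r => /eqP.
  by rewrite subr_eq addrC => /eqP.
have -> : r *: c x = r *: c (v d.+1 (u d.+1 x)) - r *: c (s' (res_diff T d x)).
  by rewrite wx scalerDr addrK.
congr (_ - _); rewrite uD toD.
have -> : r *: c (v d.+1 (u d.+1 x))
        = c (v d.+1 (ofL d.+1 (toL d.+1 (u d.+1 x) *m r%:M))).
  by rewrite mul_mx_scalar !linearZ_LR /= toK.
rewrite rE mulmxDr !mulmxA (linearD (ofL _)) ofD (linearD (v _)) vD (linearD c).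
by rewrite cZ addr0.
Qed.

End ExtAnnihilator.

(** P is the dual of the resolution F that starts with the transpose of the
    differential of L in question, so the contraction starts with the
    identity phi : P^1 -> L_d, and composing its outcome with that differential
    and using exactness of L gives the homotopy on L_(d+1). *)
Lemma kills_ann_ext (R : idomainType) (noethR : noetherian R) (M : lmodType R)
    (fgM : fin_gen M) (d : nat) (r : R) :
  (forall F, kills F (stalk M) d.+1 r) ->
  forall (P : proj_resolution M) (N : lmodType R), ann_ext P N d.+1 r.
Proof.
move=> killM P N; case: fgM => m [e eP].
have [l [C [eC C_exact]]] := relations noethR e.
pose L := syzygy_complex noethR C.
have e_span v : exists c : 'rV[R]_m, v = mxact c e ord0.
  have [c ->] := (eP v).1 I; exists (\row_k c k).
  by apply: eq_bigr => k _; rewrite mxE.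
pose F := syzygy_complex noethR (fdiff L d)^T.
have A0 : dualmx F 0 = fdiff L d by rewrite /dualmx trmxK.
have [||h [h' E]] := @stalk_contraction R M L e eC C_exact e_span F d.+1 r
  (killM F) d 0 (1%:M : 'M_(frank L d)).
- by rewrite addn1.
- rewrite A0 mulmx1 -[fdiff L d]mul1mx; exact: (@cycle_mx_boundary R M L e eC).
have [|g gE] := fexact (f := L) (k := d) (X := r%:M - fdiff L d *m h).
  rewrite mulmxBl mul_scalar_mx -mulmxA.
  have := congr1 (mulmx (dualmx F 0)) E.
  rewrite mulmxDr [X in _ = _ + X]mulmxA dualmxK mul0mx addr0 A0 => <-.
  by rewrite -scalemxAr mulmx1 subrr.
apply: (@ann_ext_of_homotopy R M L e eC C_exact e_span P N d r h g).
by rewrite -gE addrC subrK.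
Qed.

Theorem theorem4p7 (R : idomainType) (noethR : noetherian R)
    (G : dbcomplex R) (I : Type)
    (M : I -> lmodType R) (fgM : forall i, fin_gen (M i))
    (n : nat) (hM : forall i, thick G n (db_stalk (fgM i)))
    (d : nat) (d_ge1 : (1 <= d)%N) (N : I -> lmodType R)
    (P : forall i, proj_resolution (M i))
    (hann : forall r : R, (forall i, ann_ext (P i) (N i) d r) -> r = 0) :
  (d <= n)%N.
Proof.
rewrite leqNgt; apply/negP => ltnd.
have [r r0 killG] := kills_generator noethR (dbcP G).
case: d ltnd {d_ge1} hann => // d ltnd hann.
suff /eqP : r ^+ n.+1 = 0 by rewrite expf_eq0 (negPf r0) andbF.
apply: hann => i; apply: kills_ann_ext => // F.
exact: kills_mono ltnd (kills_thick (killG F) (hM i)).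
Qed.
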